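(* Let $K$ be a field. For every unique factorization monoid $M$ with $M^\times=\{1\}$ there is an isomorphism of $K$-algebras $\Phi_M:\mathscr{A}(M)\to K[[(X_p)_{p\in P(M)}]]$, and these isomorphisms are functorial in $M$ in the following sense: if $\varphi:M\to N$ is an isomorphism of such monoids, then there is an isomorphism of $K$-algebras $\psi:K[[(Y_q)_{q\in P(N)}]]\to K[[(X_p)_{p\in P(M)}]]$ such that $\psi\circ\Phi_N=\Phi_M\circ\varphi^\ast$. In particular, $\mathscr{A}(M)$ is a unique factorization domain. Also, there is a discrete valuation on $\mathscr{A}(M)$ making it into a complete metric space.
   Context: A unique factorization monoid is a commutative monoid $M$, written multiplicatively with identity $1$, such that every $a\in M\smallsetminus M^\times$ has a factorization $a=b_1\cdots b_r$ into irreducible elements, and any two such factorizations of $a$ agree up to reordering and multiplication of factors by units. (A non-unit $a$ is irreducible if $a=bc$ implies $b$ or $c$ is a unit.) $P(M)$ denotes the set of prime elements of $M$; when $M^\times=\{1\}$ these are exactly the irreducible elements. Monoid homomorphisms send $1$ to $1$. We write $d\mid a$ if $a=bd$ for some $b\in M$, and then $d^{-1}a$ denotes $b$. $\mathscr{A}(M)$ is the set of all functions $M\to K$, with pointwise addition and scaling by $K$, and with multiplication the Dirichlet product $(f\ast g)(a)=\sum_{d\mid a}f(d)g(d^{-1}a)$; its multiplicative identity is $e$ with $e(1)=1$ and $e(a)=0$ for $a\neq 1$. For a monoid homomorphism $\varphi:M\to N$, the map $\varphi^\ast:\mathscr{A}(N)\to\mathscr{A}(M)$ is $\varphi^\ast(g)=g\circ\varphi$.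 $K[[(X_p)_{p\in P(M)}]]$ is the ring of formal power series $\sum_{n}\alpha_{n}\prod_p X_p^{n_p}$, where $n=(n_p)$ ranges over all finitely supported functions $P(M)\to\mathbb{Z}_{\ge 0}$ and the coefficients $\alpha_n\in K$ are arbitrary (so each monomial involves finitely many variables, but infinitely many monomials of a given degree may occur), with the usual multiplication. The metric attached to a discrete valuation $v$ on $\mathscr{A}(M)$ is $d(f,g)=c^{v(f-g)}$ for $f\ne g$ and $d(f,f)=0$, where $c\in(0,1)$ is a fixed real number. A discrete valuation on $\mathscr{A}(M)$ means one coming from a discrete valuation on the fraction field of $\mathscr{A}(M)$.
   Formalization: For M = {1}, where A(M) = K may have no discrete valuation (e.g. K algebraically closed), only a possibly trivial integer-valued valuation making A(M) complete is asserted; for every M ≠ {1} the valuation is discrete with value group Z. *)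

(* Defs.v *)
From HB Require Import structures.
From mathcomp Require Import all_boot all_order all_algebra fraction.
From mathcomp Require Import finmap multiset.
From mathcomp Require Import boolp classical_sets functions cardinality fsbigop.
From mathcomp Require Import reals filter topology_structure uniform_structure.
From mathcomp Require Import pseudometric_structure metric_structure.

Set Implicit Arguments.
Unset Strict Implicit.
Unset Printing Implicit Defensive.

Import Order.TTheory GRing.Theory Num.Theory.

Local Open Scope classical_set_scope.
Local Open Scope ring_scope.

HB.mixin Record Monoid_isCommutative M & Monoid M := {
  mulgC : forall a b : M, (a * b = b * a)%g
}.

#[short(type="comMonoidType")]
HB.structure Definition ComMonoid := {M of Monoid_isCommutative M & Monoid M}.

HB.instance Definition _ (M : comMonoidType) :=
  SemiGroup.isCommutativeLaw.Build M (@monoid.mul M) mulgC.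

(* With [assoc] equality up to a unit: [s] and [t] agree up to reordering and
   multiplication of the factors by units. *)
Definition same_factors (T : eqType) (assoc : T -> T -> Prop) (s t : seq T) :=
  exists2 t' : seq T, perm_eq t t' & all2 (fun x y => `[< assoc x y >]) s t'.

Section MonoidDivisibility.
Variable M : comMonoidType.
Implicit Types (a b d p : M) (s t : seq M).

Definition munit a : Prop := exists b, (a * b = 1)%g.

Definition massoc a b : Prop := exists2 u, munit u & (a = b * u)%g.

Definition mirreducible a : Prop :=
  ~ munit a /\ forall b c, (a = b * c)%g -> munit b \/ munit c.

Definition mdvd d a : Prop := exists b, (a = b * d)%g.

Definition mprime p : Prop :=
  ~ munit p /\ forall a b, mdvd p (a * b)%g -> mdvd p a \/ mdvd p b.

Definition mfactorization a s : Prop :=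
  (forall b, b \in s -> mirreducible b) /\ a = (\prod_(b <- s) b)%g.

Definition unique_factorization : Prop :=
  forall a, ~ munit a ->
    (exists s, mfactorization a s) /\
    (forall s t, mfactorization a s -> mfactorization a t ->
       same_factors massoc s t).

Definition mdivisors a : set M := [set d | mdvd d a].

(* d^-1 a, with value 1 when d does not divide a *)
Definition mquo a d : M := xget 1%g [set b | a = (b * d)%g].

Definition prime_elt := {p : M | `[< mprime p >]}.
HB.instance Definition _ := Choice.on prime_elt.

End MonoidDivisibility.

HB.mixin Record ComMonoid_isReducedUF M & ComMonoid M := {
  ufm_factor : unique_factorization M;
  ufm_unit1 : forall a : M, munit a -> a = 1%g
}.

#[short(type="reducedUFMonoidType")]
HB.structure Definition ReducedUFMonoid :=
  {M of ComMonoid_isReducedUF M & ComMonoid M}.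

(* The ring laws of a convolution product over a cancellative commutative
   monoid (T, op, one) in which every a has a finite set D a of divisors d,
   with cofactors q a d. *)
Section Convolution.
Variables (K : fieldType) (T : choiceType) (op : T -> T -> T) (one : T).
Variables (D : T -> set T) (q : T -> T -> T).
Hypotheses (opA : associative op) (opC : commutative op) (op1 : left_id one op).
Hypotheses (DP : forall a d, D a d <-> exists b, a = op b d).
Hypotheses (qK : forall b d, q (op b d) d = b) (Dfin : forall a, finite_set (D a)).

Let conv (f g : T -> K) a : K := \sum_(d \in D a) f d * g (q a d).

Let qP a d : D a d -> op (q a d) d = a.
Proof. by move=> /DP[b ->]; rewrite qK. Qed.

Let Dop b d : D (op b d) d.
Proof. by apply/DP; exists b. Qed.

Let Dq a d : D a d -> D a (q a d).
Proof. by move=> Dad; apply/DP; exists d; rewrite opC qP. Qed.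

Let qq a d : D a d -> q a (q a d) = d.
Proof. by move=> Dad; rewrite -{1}(qP Dad) opC qK. Qed.

Lemma convC f g : conv f g = conv g f.
Proof.
apply/funext => a; rewrite /conv (reindex_fsbig (q a) (D a) (D a)).
  by apply: eq_fsbigr => d /set_mem Dad; rewrite qq// mulrC.
split=> [d /Dq//|d e /set_mem Dd /set_mem De eq_q|d Dd].
  by rewrite -(qq Dd) eq_q qq.
by exists (q a d); [exact: Dq | exact: qq].
Qed.

Lemma conv1 f : conv (fun a => (a == one)%:R) f = f.
Proof.
apply/funext => a; rewrite /conv -(fsbig_widen [set one]).
- by rewrite fsbig_set1 eqxx mul1r -{1}(op1 a) opC qK.
- by move=> _ ->; apply/DP; exists a; rewrite opC op1.
- by move=> d [_ /eqP/negPf/= ->]; rewrite mul0r.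
Qed.

Lemma convDl f g h : conv (f \+ g) h = conv f h \+ conv g h.
Proof.
apply/funext => a; rewrite /conv/= -fsbig_split//.
by apply: eq_fsbigr => d _; rewrite mulrDl.
Qed.

Lemma convZl c f g : conv (fun a => c * f a) g = fun a => c * conv f g a.
Proof.
apply/funext => a; rewrite /conv/= mulr_fsumr.
by apply: eq_fsbigr => d _; rewrite mulrA.
Qed.

Lemma convA f g h : conv f (conv g h) = conv (conv f g) h.
Proof.
have D_trans a c d : D a d -> D d c -> D a c.
  move=> Dad Ddc; apply/DP; exists (op (q a d) (q d c)).
  by rewrite -opA qP// qP.
apply/funext => a; rewrite /conv.
transitivity (\sum_(c \in D a) \sum_(d \in D a)
    if d \in [set e | D e c] then f c * g (q d c) * h (q a d) else 0).
  apply: eq_fsbigr => c /set_mem Dac.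
  rewrite -fsbig_mkcondr mulr_fsumr.
  rewrite (reindex_fsbig (op c) (D (q a c)) (D a `&` [set e | D e c])).
    apply: eq_fsbigr => x /set_mem Dx; rewrite [op c x]opC qK mulrA.
    suff -> : q a (op x c) = q (q a c) x by [].
    by rewrite -[RHS](qK _ (op x c)) opA qP// qP.
  split=> [x Dx|x y _ _ eq_op|d [Dad Ddc]].
  - split; last by rewrite /= opC; exact: Dop.
    by apply/DP; exists (q (q a c) x); rewrite [op c x]opC opA qP// qP.
  - by rewrite -(qK x c) opC eq_op opC qK.
  - exists (q d c); last by rewrite opC qP.
    apply/DP; exists (q a d); rewrite -[RHS](qK _ c).
    by rewrite -opA qP// qP.
rewrite exchange_fsbig//; apply: eq_fsbigr => d /set_mem Dad.
rewrite -[LHS](fsbig_mkcondr _ (D a) (D d)).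
rewrite mulr_fsuml; apply: eq_fsbigl.
by apply/seteqP; split=> [c []//|c Ddc]; split=> //; exact: D_trans Ddc.
Qed.

End Convolution.

Lemma subseq_mask_set (T : eqType) (s t : seq T) : subseq t s ->
  [set mask m s | m in [set: (size s).-tuple bool]] t.
Proof.
by move=> /subseqP[m /eqP sz ->]; exists (Tuple sz).
Qed.

Section ReducedUFMonoidTheory.
Variable M : reducedUFMonoidType.
Implicit Types (a b c d : M) (s t : seq M).

Lemma mfactorization_exists a : exists s, mfactorization a s.
Proof.
have [/ufm_unit1 ->|na] := pselect (munit a); last by case: (ufm_factor a na).
by exists [::]; split=> //; rewrite big_nil.
Qed.

Lemma mfactorization_unit a s : munit a -> mfactorization a s -> s = [::].
Proof.
move=> [b ab1]; case: s => // c s [irr]; rewrite big_cons => aE.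
have [nc _] := irr c (mem_head _ _); case: nc.
by exists ((\prod_(x <- s) x) * b)%g; rewrite mulgA -aE.
Qed.

Lemma mfactorization_perm a s t :
  mfactorization a s -> mfactorization a t -> perm_eq s t.
Proof.
move=> fs ft; have [ua|na] := pselect (munit a).
  by rewrite (mfactorization_unit ua fs) (mfactorization_unit ua ft).
have [_ /(_ _ _ fs ft)[t' tt' st']] := ufm_factor a na.
suff -> : s = t' by rewrite perm_sym.
elim: s t' st' {fs ft tt'} => [|x s IHs] [|y t']//= /andP[/asboolP[u]].
by move=> /ufm_unit1 -> ->; rewrite mulg1 => /IHs ->.
Qed.

Lemma mfactorizationM a b s t :
  mfactorization a s -> mfactorization b t -> mfactorization (a * b)%g (s ++ t).
Proof.
move=> [irs ->] [irt ->]; split; last by rewrite big_cat.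
by move=> c; rewrite mem_cat => /orP[/irs|/irt].
Qed.

Lemma ufm_mulIg d : injective (fun b => (b * d)%g).
Proof.
move=> b c /= bd_cd.
have [[[r fr] [s fs]] [t ft]] :=
  (mfactorization_exists d, mfactorization_exists b, mfactorization_exists c).
have := mfactorization_perm (mfactorizationM fs fr).
rewrite bd_cd => /(_ _ (mfactorizationM ft fr)); rewrite perm_cat2r => st.
by rewrite fs.2 ft.2; apply: perm_big.
Qed.

Lemma mquoK b d : mquo (b * d)%g d = b.
Proof.
have : exists c, (b * d = c * d)%g by exists b.
by move=> /(xgetPex 1%g)/= bdE; apply/esym/(@ufm_mulIg d).
Qed.

Lemma finite_mdivisors a : finite_set (mdivisors a).
Proof.
have [s fs] := mfactorization_exists a.
apply: (@sub_finite_set _ _ [set (\prod_(b <- t) b)%g | t in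
    [set mask m s | m in [set: (size s).-tuple bool]]]); last first.
  exact/finite_image/finite_image/finite_finset.
move=> d [b ab]; have [[t ft] [r fr]] :=
  (mfactorization_exists d, mfactorization_exists b).
have := mfactorizationM ft fr; rewrite mulgC -ab => /(mfactorization_perm fs) srt.
have [|t' /subseq_mask_set st' tt'] := (@count_subseqP _ t s).1 _.
  by move=> x; rewrite (permP srt) count_cat leq_addr.
by exists t' => //; rewrite ft.2; apply: perm_big; rewrite perm_sym.
Qed.

End ReducedUFMonoidTheory.

Definition dirichlet (K : fieldType) (M : reducedUFMonoidType) : Type := M -> K.

Section Dirichlet.
Variables (K : fieldType) (M : reducedUFMonoidType).
Local Notation A := (dirichlet K M).
Implicit Types f g h : A.

HB.instance Definition _ := GRing.Zmodule.copy A (M -> K).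

Definition dirichlet_one : A := fun a => (a == 1%g)%:R.

Definition dirichlet_mul f g : A :=
  fun a => \sum_(d \in mdivisors a) f d * g (mquo a d).

Definition dirichlet_scale (c : K) f : A := fun a => c * f a.

Let dvdP (a d : M) : mdivisors a d <-> exists b, a = (b * d)%g.
Proof. by []. Qed.

Let dirichlet_mulA : associative dirichlet_mul.
Proof.
move=> f g h.
exact: (convA (@mulgA M) (@mulgC M) dvdP (@mquoK M) (@finite_mdivisors M)).
Qed.

Let dirichlet_mulC : commutative dirichlet_mul.
Proof.
by move=> f g; apply: (convC (@mulgC M) dvdP (@mquoK M)).
Qed.

Let dirichlet_mul1 : left_id dirichlet_one dirichlet_mul.
Proof.
by move=> f; apply: (conv1 (@mulgC M) (@mul1g M) dvdP (@mquoK M)).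
Qed.

Let dirichlet_mulDl : left_distributive dirichlet_mul +%R.
Proof. by move=> f g h; apply: (convDl _ (@finite_mdivisors M)). Qed.

Let dirichlet_one_neq0 : dirichlet_one != 0.
Proof.
by apply/eqP => /(congr1 (@^~ 1%g)) /eqP; rewrite /dirichlet_one eqxx oner_eq0.
Qed.

HB.instance Definition _ := GRing.Zmodule_isComNzRing.Build A
  dirichlet_mulA dirichlet_mulC dirichlet_mul1 dirichlet_mulDl
  dirichlet_one_neq0.

Let dirichlet_scaleA b c f :
  dirichlet_scale b (dirichlet_scale c f) = dirichlet_scale (b * c) f.
Proof. by apply/funext => a; rewrite /dirichlet_scale mulrA. Qed.

Let dirichlet_scale1 : left_id 1 dirichlet_scale.
Proof. by move=> f; apply/funext => a; rewrite /dirichlet_scale mul1r. Qed.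

Let dirichlet_scaleDr : right_distributive dirichlet_scale +%R.
Proof. by move=> c f g; apply/funext => a; exact: mulrDr. Qed.

Let dirichlet_scaleDl f : {morph dirichlet_scale^~ f : b c / b + c}.
Proof. by move=> b c; apply/funext => a; exact: mulrDl. Qed.

HB.instance Definition _ := GRing.Zmodule_isLmodule.Build K A
  dirichlet_scaleA dirichlet_scale1 dirichlet_scaleDr dirichlet_scaleDl.

Let dirichlet_scaleAl (c : K) (f g : A) : c *: (f * g) = (c *: f) * g.
Proof. exact/esym/convZl. Qed.

HB.instance Definition _ := GRing.Lmodule_isLalgebra.Build K A dirichlet_scaleAl.
HB.instance Definition _ := GRing.Lalgebra_isComAlgebra.Build K A.

Definition dirichlet_unit : {pred A} := fun f => `[< exists g : A, g * f = 1 >].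

Definition dirichlet_inv f : A :=
  if f \in dirichlet_unit then xget f [set g | g * f = 1] else f.

Let dirichlet_mulV : {in dirichlet_unit, left_inverse 1 dirichlet_inv *%R}.
Proof.
move=> f uf; rewrite /dirichlet_inv uf.
by move: uf => /asboolP; exact: xgetPex.
Qed.

Let dirichlet_unitP (f g : A) : g * f = 1 -> f \in dirichlet_unit.
Proof. by move=> gf1; apply/asboolP; exists g. Qed.

Let dirichlet_inv_out : {in [predC dirichlet_unit], dirichlet_inv =1 id}.
Proof. by move=> f; rewrite inE /dirichlet_inv => /negPf ->. Qed.

HB.instance Definition _ := GRing.ComNzRing_hasMulInverse.Build A
  dirichlet_mulV dirichlet_unitP dirichlet_inv_out.

End Dirichlet.

(* Formal power series in the variables X_i, i : I.  A multiset n : {mset I},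
   i.e. a finitely supported function I -> nat, is the exponent of the monomial
   \prod_i X_i ^ (n i), and [s n] is the coefficient of that monomial in s. *)
Definition powerseries (K : fieldType) (I : choiceType) : Type := {mset I}%mset -> K.

Section PowerSeries.
Variables (K : fieldType) (I : choiceType).
Local Notation S := (powerseries K I).
Implicit Types s t : S.

HB.instance Definition _ := GRing.Zmodule.copy S ({mset I}%mset -> K).

Definition powerseries_one : S := fun n => (n == mset0)%:R.

Definition powerseries_mul s t : S :=
  fun n => \sum_(k \in [set k | (k `<=` n)%mset]) s k * t (n `\` k)%mset.

Definition powerseries_scale (c : K) s : S := fun n => c * s n.

Let submP (n k : {mset I}%mset) :
  [set k | (k `<=` n)%mset] k <-> exists m, n = (m `+` k)%mset.
Proof.
split=> [/= kn|[m ->]]; last first.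
  by apply/msubsetP => i; rewrite msetE2 leq_addl.
exists (n `\` k)%mset; apply/msetP => i.
by rewrite !msetE2 subnK//; exact: (msubsetP kn).
Qed.

Let msetBK (m k : {mset I}%mset) : ((m `+` k) `\` k)%mset = m.
Proof. by apply/msetP => i; rewrite !msetE2 addnK. Qed.

Let finite_subm (n : {mset I}%mset) : finite_set [set k | (k `<=` n)%mset].
Proof.
pose s : seq I := n.
apply: (@sub_finite_set _ _ [set seq_mset t | t in
    [set mask m s | m in [set: (size s).-tuple bool]]]); last first.
  exact/finite_image/finite_image/finite_finset.
move=> k /= /msubsetP kn.
have [|t /subseq_mask_set st kt] := (@count_subseqP _ (k : seq I) s).1 _.
  by move=> x; rewrite !count_mem_mset.
by exists t => //; rewrite -[RHS]seq_mset_id; apply/eq_seq_msetP; rewrite perm_sym.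
Qed.

Let powerseries_mulA : associative powerseries_mul.
Proof.
move=> s t u; exact: (convA (@msetDA I) (@msetDC I) submP msetBK finite_subm).
Qed.

Let powerseries_mulC : commutative powerseries_mul.
Proof. by move=> s t; apply: (convC (@msetDC I) submP msetBK). Qed.

Let powerseries_mul1 : left_id powerseries_one powerseries_mul.
Proof. by move=> s; apply: (conv1 (@msetDC I) (@mset0D I) submP msetBK). Qed.

Let powerseries_mulDl : left_distributive powerseries_mul +%R.
Proof. by move=> s t u; apply: (convDl _ finite_subm). Qed.

Let powerseries_one_neq0 : powerseries_one != 0.
Proof.
apply/eqP => /(congr1 (@^~ mset0)) /eqP.
by rewrite /powerseries_one eqxx oner_eq0.
Qed.

HB.instance Definition _ := GRing.Zmodule_isComNzRing.Build S
  powerseries_mulA powerseries_mulC powerseries_mul1 powerseries_mulDl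
  powerseries_one_neq0.

Let powerseries_scaleA b c s :
  powerseries_scale b (powerseries_scale c s) = powerseries_scale (b * c) s.
Proof. by apply/funext => n; rewrite /powerseries_scale mulrA. Qed.

Let powerseries_scale1 : left_id 1 powerseries_scale.
Proof. by move=> s; apply/funext => n; rewrite /powerseries_scale mul1r. Qed.

Let powerseries_scaleDr : right_distributive powerseries_scale +%R.
Proof. by move=> c s t; apply/funext => n; exact: mulrDr. Qed.

Let powerseries_scaleDl s : {morph powerseries_scale^~ s : b c / b + c}.
Proof. by move=> b c; apply/funext => n; exact: mulrDl. Qed.

HB.instance Definition _ := GRing.Zmodule_isLmodule.Build K S
  powerseries_scaleA powerseries_scale1 powerseries_scaleDr powerseries_scaleDl.

Let powerseries_scaleAl (c : K) (s t : S) : c *: (s * t) = (c *: s) * t.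
Proof. exact/esym/convZl. Qed.

HB.instance Definition _ :=
  GRing.Lmodule_isLalgebra.Build K S powerseries_scaleAl.
HB.instance Definition _ := GRing.Lalgebra_isComAlgebra.Build K S.

End PowerSeries.

Definition idomain_of (R : comUnitRingType)
    (intR : GRing.integral_domain_axiom R) : idomainType :=
  HB.pack_for idomainType R (GRing.ComUnitRing_isIntegral.Build R intR).

Section UniqueFactorizationDomain.
Variable R : idomainType.
Implicit Types (a b : R) (s t : seq R).

Definition rassoc a b : Prop := exists2 u, u \is a GRing.unit & a = b * u.

Definition rirreducible a : Prop :=
  [/\ a != 0, a \isn't a GRing.unit &
     forall b c, a = b * c -> b \is a GRing.unit \/ c \is a GRing.unit].

Definition rfactorization a s : Prop :=
  (forall b, b \in s -> rirreducible b) /\ a = \prod_(b <- s) b.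

Definition unique_factorization_domain : Prop :=
  forall a, a != 0 -> a \isn't a GRing.unit ->
    (exists s, rfactorization a s) /\
    (forall s t, rfactorization a s -> rfactorization a t ->
       same_factors rassoc s t).

End UniqueFactorizationDomain.

(* Integer-valued valuations on F^*, possibly trivial; v 0 is irrelevant. *)
Definition valuation (F : fieldType) (v : F -> int) : Prop :=
  (forall x y, x != 0 -> y != 0 -> v (x * y) = v x + v y) /\
  (forall x y, x != 0 -> y != 0 -> x + y != 0 ->
     Num.min (v x) (v y) <= v (x + y)).

(* Normalized: the value group is all of Z.  Such a v need not exist on a given
   field; an algebraically closed field, for instance, has none. *)
Definition discrete_valuation (F : fieldType) (v : F -> int) : Prop :=
  valuation v /\ forall n : int, exists2 x, x != 0 & v x = n.

Definition valuation_dist (R : realType) (c : R) (D : idomainType)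
    (v : {fraction D} -> int) (f g : D) : R :=
  if f == g then 0 else c ^ v (tofrac (f - g)).

Record metric_axioms (R : realType) (T : Type) (d : T -> T -> R) : Prop :=
  MetricAxioms {
    metric_axioms_xx : forall x, d x x = 0;
    metric_axioms_eq : forall x y, d x y = 0 -> x = y;
    metric_axioms_sym : forall x y, d x y = d y x;
    metric_axioms_triangle : forall y x z, d x z <= d x y + d y z
  }.

Definition metric_space (R : realType) (T : choiceType) (d : T -> T -> R)
  of metric_axioms d : Type := T.

Section MetricSpace.
Variables (R : realType) (T : choiceType) (d : T -> T -> R).
Variable md : metric_axioms d.

HB.instance Definition _ := Choice.on (metric_space md).
HB.instance Definition _ := isMetric.Build R (metric_space md)
  (metric_axioms_xx md) (metric_axioms_eq md) (metric_axioms_sym md)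
  (metric_axioms_triangle md).

End MetricSpace.

(* [Uniform_isComplete] is not used because it requires a pointed type. *)
Definition complete_metric (R : realType) (T : choiceType) (d : T -> T -> R) :=
  exists md : metric_axioms d,
    forall F : set_system (metric_space md), ProperFilter F -> cauchy F ->
      exists l : metric_space md, F --> l.

(* Main.v *)
Require Import Defs.
From HB Require Import structures.
From mathcomp Require Import all_boot all_order all_algebra fraction.
From mathcomp Require Import finmap multiset.
From mathcomp Require Import boolp classical_sets functions cardinality fsbigop.
From mathcomp Require Import reals filter topology_structure uniform_structure.
From mathcomp Require Import pseudometric_structure metric_structure.
From mathcomp Require Import wochoice fieldext zify ring lra.

(** The monoid [M] is free commutative on its primes, so a function on [M] is the
    same as a family of coefficients indexed by the monomials in the primes, and
    the divisors of an element correspond to the divisors of its monomial. Hence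
    the Dirichlet product becomes the product of power series, which gives the
    isomorphism [dirichlet_series]; an isomorphism of monoids respects divisors,
    which gives functoriality ([powerseries_pullback]).

    It remains to study the ring of power series over [K] in an arbitrary set of
    variables. Well-order the variables, and compare two monomials by the exponents
    of the largest variable in which they differ. This is a well-order compatible
    with multiplication ([mon_lt_wf]); the smallest monomial of a nonzero series,
    called leading, is multiplicative ([leadM]), so the ring is a domain. Recursion
    along the order gives a division algorithm ([ps_division]): modulo a series
    with leading monomial [m], every series has a representative without multiples
    of [m]. Three facts follow from division. A series with nonzero constant
    coefficient is a unit. The ring is integrally closed
    ([ps_integrally_closed]). A series whose leading monomial is a power [x ^ d]
    of the least variable is associated to a monic polynomial of degree [d] in [x]
    whose coefficients do not involve [x] ([weierstrass_preparation]).

    Irreducible series are prime ([ps_irreducible_prime]). If the leading monomial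
    of an irreducible series contains a variable [y] other than [x], then the
    automorphism [y |-> y + x ^ N], for suitable [N], lowers this monomial
    ([shear_lead]). By well-founded induction the leading monomial may be assumed
    to be a power of [x], and the series to be a Weierstrass polynomial. Since the
    ring is integrally closed, a monic factor over the fraction field has its
    coefficients in the ring ([monic_dvdp_integral]); so the polynomial is
    irreducible over the fraction field, hence prime there, and division by it
    brings primality back to the ring. Factorizations exist because the degree of
    the lowest form of a series is additive and is 0 only for units, and they are
    unique because irreducible elements are prime ([ufd_of_prime]).

    The valuation is this degree, extended to fractions. The metric is complete
    because along a Cauchy sequence each coefficient is eventually constant
    ([ps_complete], [valuation_complete]). *)

Set Implicit Arguments.
Unset Strict Implicit.
Unset Printing Implicit Defensive.

Import Order.TTheory GRing.Theory Num.Theory.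

Local Open Scope ring_scope.

(** * A well-order on monomials *)

Section MonomialOrder.
Local Open Scope nat_scope.
Local Open Scope mset_scope.
Variable I : choiceType.
Implicit Types (i j k : I) (m n p : {mset I}).

Definition var_le : rel I := sval (well_ordering_principle I).

Definition var_lt i j := (i != j) && var_le i j.

Lemma var_le_min (P : I -> Prop) : (exists i, P i) ->
  exists2 i, P i & forall j, P j -> var_le i j.
Proof.
move=> [i Pi]; have := svalP (well_ordering_principle I).
move=> /(_ (fun j => `[< P j >]))[|k [[/asboolP Pk kmin] _]].
  by exists i; apply/asboolP.
by exists k => // j Pj; apply: kmin; apply/asboolP.
Qed.

Lemma var_le_total : total var_le.
Proof.
move=> i j; have [|k [->|->] kmin] := @var_le_min (fun k => k = i \/ k = j).
- by exists i; left.
- by rewrite (kmin j) //; right.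
- by rewrite (kmin i) ?orbT //; left.
Qed.

Lemma var_le_anti : antisymmetric var_le.
Proof.
move=> i j /andP[ij ji]; have := svalP (well_ordering_principle I).
move=> /(_ (mem [:: i; j]))[|k [_ kmin]]; first by exists i; rewrite !inE eqxx.
have le_refl l : var_le l l by have := var_le_total l l; rewrite orbb.
have kmin' l : l \in [:: i; j] -> var_le l i && var_le l j -> k = l.
  move=> l_ij /andP[li lj]; apply: kmin; split=> // l'.
  by rewrite !inE => /orP[] /eqP ->.
transitivity k; last by apply: kmin'; rewrite ?ji ?le_refl // !inE eqxx orbT.
by apply/esym/kmin'; rewrite ?ij ?le_refl // !inE eqxx.
Qed.

Lemma var_le_trans : transitive var_le.
Proof.
move=> j i k ij jk.
have [|l [->|[->|->]] lmin] := @var_le_min (fun l => l = i \/ l = j \/ l = k).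
- by exists i; left.
- by apply: lmin; right; right.
- by rewrite (@var_le_anti i j) // ij lmin //; left.
- by rewrite -(@var_le_anti j k) // jk lmin //; right; left.
Qed.

Lemma var_lt_trans : transitive var_lt.
Proof.
move=> j i k /andP[nij ij] /andP[njk jk].
rewrite /var_lt (var_le_trans ij jk) andbT; apply: contra nij => /eqP eik.
by rewrite (@var_le_anti i j) // ij eik.
Qed.

Lemma var_ltxx i : var_lt i i = false.
Proof. by rewrite /var_lt eqxx. Qed.

Lemma var_lt_neq_total i j : i != j -> var_lt i j || var_lt j i.
Proof. by rewrite /var_lt (eq_sym j) => ->; apply: var_le_total. Qed.

Lemma var_lt_wf : well_founded var_lt.
Proof.
move=> i; apply: contrapT => nAi.
have [|j nAj jmin] := @var_le_min (fun j => ~ Acc var_lt j); first by exists i.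
apply: nAj; constructor=> k /andP[nkj kj]; apply: contrapT => /jmin jk.
by move: nkj; rewrite (@var_le_anti k j) ?eqxx // kj.
Qed.

Lemma var_lt_max (P : I -> Prop) (s : seq I) :
    (forall i, P i -> i \in s) -> (exists i, P i) ->
  exists2 i, P i & forall j, var_lt i j -> ~ P j.
Proof.
elim: s P => [|x s IHs] P Ps [i Pi]; first by have := Ps _ Pi.
have [[j Pj xj]|nP] := pselect (exists2 j, P j & var_lt x j).
  have [||k [Pk xk] kmax] := IHs (fun k => P k /\ var_lt x k).
  - move=> k [/Ps]; rewrite inE => /orP[/eqP ->|//].
    by rewrite var_ltxx.
  - by exists j.
  exists k => // l kl Pl; apply: (kmax l kl); split=> //.
  exact: var_lt_trans kl.
have [Px|nPx] := pselect (P x); first by exists x => // j xj Pj; apply: nP; exists j.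
apply: IHs; last by exists i.
by move=> j Pj; have := Ps _ Pj; rewrite inE => /orP[/eqP jx|//]; rewrite jx in Pj.
Qed.

Lemma mset_neq0_ex m : m <> mset0 -> exists i, m i <> 0.
Proof.
move=> m0; apply: contrapT => nex; apply: m0; apply/msetP => i.
by rewrite mset0E; apply: contrapT => mi; apply: nex; exists i.
Qed.

Lemma var_lt_max_supp m : m <> mset0 ->
  exists2 i, m i <> 0 & forall j, var_lt i j -> m j = 0.
Proof.
move=> /mset_neq0_ex ex_i.
have [i|i mi imax] := @var_lt_max (fun i => m i <> 0) (finsupp m) _ ex_i.
  by move=> /eqP; rewrite mset_neq0 msuppE.
by exists i => // j ij; apply: contrapT; apply: imax.
Qed.

(** Lexicographic comparison in which the largest variable decides first, so
    that the powers of the least variable precede every monomial containing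
    another variable. *)
Definition mon_lt m n :=
  exists2 i, m i < n i & forall j, var_lt i j -> m j = n j.

Lemma mon_lt_total m n : m <> n -> mon_lt m n \/ mon_lt n m.
Proof.
move=> neq_mn.
have [||i mni imax] := @var_lt_max (fun i => m i <> n i) (finsupp m ++ finsupp n).
- move=> i; apply: contra_notT; rewrite mem_cat !msuppE negb_or -!mset_eq0.
  by move=> /andP[/eqP -> /eqP ->].
- apply: contrapT => nex; apply: neq_mn; apply/msetP => i.
  by apply: contrapT => mni; apply: nex; exists i.
have max j : var_lt i j -> m j = n j by move=> /imax; apply: contrapT.
case: (ltngtP (m i) (n i)) mni => // mni _; [left|right]; exists i => // j ij.
by rewrite max.
Qed.

Lemma mon_lt_trans m n p : mon_lt m n -> mon_lt n p -> mon_lt m p.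
Proof.
move=> [i mi mj] [j nj nk].
have [eij|/var_lt_neq_total/orP[ij|ji]] := eqVneq i j.
- exists i; first by rewrite (ltn_trans mi) // eij.
  by move=> l il; rewrite mj // nk // -eij.
- exists j; first by rewrite mj.
  by move=> l jl; rewrite mj ?nk // (var_lt_trans ij jl).
- exists i; first by rewrite -nk.
  by move=> l il; rewrite mj // nk // (var_lt_trans ji il).
Qed.

Lemma mon_ltxx m : ~ mon_lt m m.
Proof. by move=> [i]; rewrite ltnn. Qed.

Lemma mon_ltD2r p m n : mon_lt m n -> mon_lt (m `+` p) (n `+` p).
Proof.
move=> [i mi mj]; exists i; first by rewrite !msetE2 ltn_add2r.
by move=> j ij; rewrite !msetE2 mj.
Qed.

(** Induction on the largest variable that occurs: the monomials in the
    variables up to [i] are ordered lexicographically by the exponent of [i] and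
    then by the monomial [rest] in the smaller variables. *)
Lemma mon_lt_wf : well_founded mon_lt.
Proof.
suff upto i n : (forall j, var_lt i j -> n j = 0) -> Acc mon_lt n.
  move=> n; have [->|] := pselect (n = mset0).
    by constructor=> m [i]; rewrite mset0E.
  by move=> /var_lt_max_supp[i _]; apply: upto.
elim/(well_founded_ind var_lt_wf): i n => i IHi n.
have below p : (forall j, ~~ var_lt j i -> p j = 0) -> Acc mon_lt p.
  move=> p0; have [->|] := pselect (p = mset0).
    by constructor=> m [j]; rewrite mset0E.
  move=> /var_lt_max_supp[k pk kmax]; apply: (IHi k) => //.
  by apply: contra_notT pk => /p0.
have [a] := ubnP (n i); elim: a n => [n|a IHa n na n0]; first by rewrite ltn0.
pose rest m := m `\` msetn (m i) i.
have restE m j : rest m j = if j == i then 0 else m j.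
  by rewrite msetE2 msetnE; case: eqP => [->|_]; rewrite ?subnn ?subn0.
have rest0 m : (forall j, var_lt i j -> m j = 0) ->
    forall j, ~~ var_lt j i -> rest m j = 0.
  move=> m0 j ji; rewrite restE; case: eqVneq => // nij.
  by apply: m0; have := var_lt_neq_total nij; rewrite (negPf ji).
have := below _ (rest0 _ n0); move Ep : (rest n) => p Ap.
elim: Ap n na n0 Ep => {}p _ IHp n na n0 Ep; constructor=> m mn.
have m0 j : var_lt i j -> m j = 0.
  move=> ij; case: mn => k mk kmax.
  have ki : ~~ var_lt i k by apply: contraTN mk => /n0 ->.
  rewrite kmax ?n0 //; have [<-//|nki] := eqVneq i k.
  by apply: var_lt_trans ij; have := var_lt_neq_total nki; rewrite (negPf ki).
have [mi|mi] := ltnP (m i) (n i); first by apply: IHa => //; lia.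
have [k mk kmax] := mn; have ik : i != k.
  by apply: contraTneq mk => <-; rewrite -leqNgt.
have mni : m i = n i.
  have /orP[ik'|/kmax//] := var_lt_neq_total ik.
  by move: mk; rewrite n0 // m0.
apply: (IHp (rest m)) => //; last by rewrite mni.
rewrite -Ep; exists k; first by rewrite !restE eq_sym (negPf ik).
by move=> j kj; rewrite !restE; case: ifP => // _; apply: kmax.
Qed.

End MonomialOrder.

(** * Leading monomials and division *)

Section PowerSeriesCoefficients.
Local Open Scope mset_scope.
Local Open Scope ring_scope.
Variables (K : fieldType) (I : choiceType).
Implicit Types (m n p k : {mset I}) (s t : powerseries K I).

Definition submsets n : set {mset I} := [set k | (k `<=` n)%mset]%classic.

Lemma finite_submsets n : finite_set (submsets n).
Proof.
apply: (@sub_finite_set _ _ [set seq_mset t | t in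
    [set mask m (n : seq I) | m in [set: (size n).-tuple bool]]]%classic); last first.
  exact/finite_image/finite_image/finite_finset.
move=> k /= /msubsetP kn.
have [|t /subseq_mask_set st kt] := (@count_subseqP _ (k : seq I) (n : seq I)).1 _.
  by move=> x; rewrite !count_mem_mset.
by exists t => //; rewrite -[RHS]seq_mset_id; apply/eq_seq_msetP; rewrite perm_sym.
Qed.

Lemma psME s t n : (s * t) n = \sum_(k \in submsets n) s k * t (n `\` k).
Proof. by []. Qed.

Lemma psDE s t n : (s + t) n = s n + t n. Proof. by []. Qed.

Lemma psBE s t n : (s - t) n = s n - t n. Proof. by []. Qed.

Lemma psM_neq0 s t n : (s * t) n != 0 ->
  exists2 k, k `<=` n & (s k != 0) && (t (n `\` k) != 0).
Proof.
move=> st0; apply: contrapT => nex; move: st0; rewrite psME fsbig1 ?eqxx //.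
move=> k kn; apply: contra_notP nex => /eqP; rewrite mulf_eq0 negb_or => stk.
by exists k.
Qed.

Lemma psM_single s t n k : k `<=` n ->
    (forall l, l `<=` n -> l != k -> s l != 0 -> t (n `\` l) != 0 -> False) ->
  (s * t) n = s k * t (n `\` k).
Proof.
move=> kn single; rewrite psME -(fsbig_widen [set k]%classic).
- by rewrite fsbig_set1.
- by move=> _ ->.
- move=> l [ln /= /eqP lk]; apply: contrapT => /eqP; rewrite mulf_eq0 negb_or.
  by move=> /andP[]; apply: single.
Qed.

Definition monomial n : powerseries K I := fun k => (k == n)%:R.

Lemma monomial0 : monomial mset0 = 1.
Proof. by []. Qed.

Lemma monomialM_coef n t k : (monomial n * t) (n `+` k) = t k.
Proof.
rewrite (@psM_single _ _ _ n).
- rewrite /monomial eqxx mul1r; congr (t _).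
  by apply/msetP => i; rewrite !msetE2 addKn.
- by apply/msubsetP => i; rewrite msetE2 leq_addr.
- by move=> l _ /negPf ln; rewrite /monomial ln /= eqxx.
Qed.

Lemma monomialM_coef0 n t k : ~~ (n `<=` k) -> (monomial n * t) k = 0.
Proof.
move=> nk; apply/eqP; apply: contraNT nk => /psM_neq0[l lk /andP[+ _]].
by rewrite /monomial; case: (eqVneq l n) lk => [->//|_ _]; rewrite /= eqxx.
Qed.

Lemma monomialM n k : monomial n * monomial k = monomial (n `+` k).
Proof.
apply/funext => p; have [/msetBDKC <-|np] := boolP (n `<=` p).
  rewrite monomialM_coef /monomial; congr (nat_of_bool _)%:R.
  apply/eqP/eqP => [->//|/msetP e]; apply/msetP => i.
  by have := e i; rewrite !msetE2; lia.
rewrite monomialM_coef0 // /monomial; case: eqP np => // ->.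
by move=> /msubsetP[] i; rewrite msetE2 leq_addr.
Qed.

Definition mset_muln m d : {mset I} := iter d (msetD m) mset0.

Lemma mset_mulnE m d i : mset_muln m d i = (d * m i)%N.
Proof.
by elim: d => [|d IHd]; rewrite ?mset0E //= msetE2 IHd mulSn.
Qed.

Lemma monomialXn n d : monomial n ^+ d = monomial (mset_muln n d).
Proof. by elim: d => //= d IHd; rewrite exprS IHd monomialM. Qed.

(** As for standard bases in local rings, the smallest monomial leads: a power
    series has no largest one. *)
Definition lead s m := s m != 0 /\ forall n, mon_lt n m -> s n = 0.

Lemma lead_exists s : s != 0 -> exists m, lead s m.
Proof.
move=> s0; have [m sm] : exists m, s m != 0.
  apply: contrapT => nex; move/eqP: s0; apply; apply/funext => m.
  by apply: contrapT => /eqP sm; apply: nex; exists m.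
elim/(well_founded_ind (@mon_lt_wf I)): m sm => m IHm sm.
have [[n nm sn]|nex] := pselect (exists2 n, mon_lt n m & s n != 0).
  exact: IHm sn.
by exists m; split=> // n nm; apply: contrapT => /eqP sn; apply: nex; exists n.
Qed.

Lemma lead_neq0 s m : lead s m -> s != 0.
Proof. by move=> [sm _]; apply: contraNneq sm => ->. Qed.

Lemma lead_min s m n : lead s m -> s n != 0 -> m = n \/ mon_lt m n.
Proof.
move=> [_ sm] sn; have [->|/mon_lt_total[mn|/sm/eqP nm]] := pselect (m = n).
- by left.
- by right.
- by rewrite nm in sn.
Qed.

Lemma lead_uniq s m n : lead s m -> lead s n -> m = n.
Proof.
move=> lm ln; have [//|mn] := lead_min lm ln.1.
have [//|nm] := lead_min ln lm.1; case: (mon_ltxx (mon_lt_trans mn nm)).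
Qed.

Lemma mon_leD m n k l : m = k \/ mon_lt m k -> n = l \/ mon_lt n l ->
  (m = k /\ n = l) \/ mon_lt (m `+` n) (k `+` l).
Proof.
move=> [->|mk] [->|nl]; [by left|right..].
- by rewrite !(msetDC k); apply: mon_ltD2r.
- exact: mon_ltD2r.
- by apply: (mon_lt_trans (mon_ltD2r n mk)); rewrite !(msetDC k); apply: mon_ltD2r.
Qed.

(** A product of two terms reaches the monomial [m `+` n], or a smaller one,
    only when both factors are the leading terms. *)
Lemma leadM s t m n : lead s m -> lead t n -> lead (s * t) (m `+` n).
Proof.
move=> ls lt; have mD : m `<=` m `+` n.
  by apply/msubsetP => i; rewrite msetE2 leq_addr.
have split k p : k `<=` p -> s k != 0 -> t (p `\` k) != 0 ->
    (m = k /\ n = p `\` k) \/ mon_lt (m `+` n) p.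
  move=> kp sk tk; rewrite -(msetBDKC kp).
  by have := mon_leD (lead_min ls sk) (lead_min lt tk); rewrite msetBDKC.
have mnK : (m `+` n) `\` m = n by apply/msetP => i; rewrite !msetE2 addKn.
split=> [|p pmn].
- rewrite (@psM_single _ _ _ m) // ?mnK ?mulf_neq0 ?(ls.1) ?(lt.1) //.
  by move=> k kp km sk tk; have [[/esym/eqP]|/mon_ltxx//] := split _ _ kp sk tk;
    rewrite (negPf km).
- apply/eqP/negP => /negP /psM_neq0[k kp /andP[sk tk]].
  have [[mk nk]|mnp] := split _ _ kp sk tk.
    by move: pmn; rewrite mk nk msetBDKC // => /mon_ltxx.
  exact: mon_ltxx (mon_lt_trans pmn mnp).
Qed.

Lemma leadXn s m d : lead s m -> lead (s ^+ d) (mset_muln m d).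
Proof.
move=> ls; elim: d => [|d IHd]; last by rewrite exprS; apply: leadM.
split=> [|n [i]]; last by rewrite mset0E.
by rewrite expr0 -monomial0 /monomial eqxx oner_eq0.
Qed.

(** Course-of-values recursion along the order of monomials; replacing [q] by 0
    outside the monomials below [n] is what restricts [F] to earlier values. *)
Lemma mon_rec (F : {mset I} -> ({mset I} -> K) -> K) :
  exists q, forall n, q n = F n (fun k => if `[< mon_lt k n >] then q k else 0).
Proof.
pose G n (rec : forall k, mon_lt k n -> K) := F n (fun k =>
  if pselect (mon_lt k n) is left kn then rec k kn else 0).
exists (Fix (@mon_lt_wf I) (fun=> K) G) => n; rewrite Fix_eq /G.
  congr (F n _); apply/funext => k.
  by case: pselect => kn; case: asboolP.
move=> p f g fg; congr (F p _); apply/funext => k.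
by case: pselect => // kn; rewrite fg.
Qed.

(** The coefficient of [q * b] at [n `+` m] is [q n * b m] plus terms involving
    only the [q k] with [k] smaller than [n], since [b] has no term below [m].
    Requiring it to equal the coefficient of [a] therefore determines [q]
    recursively. *)
Lemma ps_division b m : lead b m -> forall a, exists q r : powerseries K I,
  a = q * b + r /\ forall n, m `<=` n -> r n = 0.
Proof.
move=> lb a; have [q qE] := mon_rec (fun n q =>
  (a (n `+` m) - \sum_(k \in submsets (n `+` m)) q k * b ((n `+` m) `\` k)) / b m).
exists q, (a - (q : powerseries K I) * b); split; first by rewrite addrC subrK.
move=> n mn; rewrite -(msetBDK mn); move: (n `\` m) => {mn}n.
have nD : submsets (n `+` m) n by apply/msubsetP => i; rewrite msetE2 leq_addr.
have qb : ((q : powerseries K I) * b) (n `+` m) = q n * b m +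
    \sum_(k \in submsets (n `+` m)) (if `[< mon_lt k n >] then q k else 0) *
                                    b ((n `+` m) `\` k).
  have fin := finite_submsets (n `+` m).
  rewrite psME (fsbigD1 n _ _ fin nD) [in RHS](fsbigD1 n _ _ fin nD).
  have nK : (n `+` m) `\` n = m by apply/msetP => i; rewrite !msetE2 addKn.
  rewrite nK /=; case: asboolP => [/mon_ltxx//|_]; rewrite mul0r add0r; congr (_ + _).
  apply: eq_fsbigr => k /set_mem[/= knm kn]; case: asboolP => // nkn.
  rewrite mul0r; have [//|nk] := mon_lt_total kn.
  have [->|bk] := eqVneq (b ((n `+` m) `\` k)) 0; first by rewrite mulr0.
  have := mon_leD (or_intror nk) (lead_min lb bk); rewrite msetBDKC //.
  by case=> [[/esym//]|/mon_ltxx].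
by rewrite psBE qb [q n]qE divfK ?(lb.1) // subrK subrr.
Qed.

End PowerSeriesCoefficients.

(** * Power series form an integrally closed domain *)

Section PowerSeriesDomain.
Local Open Scope mset_scope.
Local Open Scope ring_scope.
Variables (K : fieldType) (I : choiceType).
Local Notation S := (powerseries K I).
Implicit Types (m n k : {mset I}) (s t : S).

Lemma psM_coef0 s t : (s * t) mset0 = s mset0 * t mset0.
Proof.
rewrite (@psM_single _ _ _ _ _ mset0) ?msetB0 ?msubset_refl //.
by move=> l; rewrite msubset0 => ->.
Qed.

(** Division of 1 by a series whose leading monomial is 1: every monomial is a
    multiple of 1, so the remainder vanishes. *)
Lemma ps_inverse s : s mset0 != 0 -> exists t, t * s = 1.
Proof.
move=> s0; have ls : lead s mset0 by split=> // n [i]; rewrite mset0E.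
have [q [r [-> r0]]] := ps_division ls 1; exists q.
suff -> : r = 0 by rewrite addr0.
by apply/funext => n; apply: r0; apply: msub0set.
Qed.

Lemma ps_integral_domain : GRing.integral_domain_axiom S.
Proof.
move=> s t st0; rewrite -[_ || _]negbK negb_or; apply/negP => /andP[].
move=> /lead_exists[m lm] /lead_exists[n ln].
by have := lead_neq0 (leadM lm ln); rewrite st0 eqxx.
Qed.

Definition ps_unit : {pred S} := fun s => s mset0 != 0.

Definition ps_inv s : S :=
  if s \in ps_unit then xget s [set t | t * s = 1]%classic else s.

Lemma ps_mulV : {in ps_unit, left_inverse 1 ps_inv *%R}.
Proof.
by move=> s us; rewrite /ps_inv us; exact: (xgetPex s (ps_inverse us)).
Qed.

Lemma ps_unitP s t : t * s = 1 -> s \in ps_unit.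
Proof.
move=> /(congr1 (fun u : S => u mset0)); rewrite psM_coef0 => ts1.
rewrite unfold_in /ps_unit; apply: contraTneq isT => s0.
by move: ts1; rewrite s0 mulr0 -monomial0 /monomial eqxx => /esym/eqP; rewrite oner_eq0.
Qed.

Lemma ps_inv_out : {in [predC ps_unit], ps_inv =1 id}.
Proof. by move=> s; rewrite inE /ps_inv => /negPf ->. Qed.

HB.instance Definition _ := GRing.ComNzRing_hasMulInverse.Build S
  ps_mulV ps_unitP ps_inv_out.
HB.instance Definition _ := GRing.ComUnitRing_isIntegral.Build S
  ps_integral_domain.

Lemma ps_unitE s : (s \is a GRing.unit) = (s mset0 != 0).
Proof. by []. Qed.

End PowerSeriesDomain.

Section FractionField.
Variable D : idomainType.

Lemma frac_div (z : {fraction D}) :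
  exists a b, b != 0 /\ z = tofrac a / tofrac b.
Proof.
elim/quotW: z => x; exists (frac x).1, (frac x).2.
have d0 := denom_ratioP x; split=> //.
have d0' : tofrac (frac x).2 != 0 by rewrite tofrac_eq0.
apply: (mulIf d0'); rewrite divfK //; unlock FracField.tofrac.
rewrite -[LHS]FracField.pi_mul; apply/eqmodP => /=.
rewrite FracField.equivfE /FracField.mulf !numden_Ratio ?mulf_neq0 ?oner_eq0 //.
by rewrite !mulr1 mulrC.
Qed.

Lemma tofrac_inj : injective (@FracField.tofrac D).
Proof. by move=> a b /eqP; rewrite tofrac_eq => /eqP. Qed.

End FractionField.

Section IntegrallyClosed.
Local Open Scope mset_scope.
Local Open Scope ring_scope.
Variables (K : fieldType) (I : choiceType).
Local Notation S := (powerseries K I).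

(** The powers of an integral [r / b] are combinations of those with exponent
    less than the degree [k] of an integral equation, so [b ^+ k] is a common
    denominator of all of them. *)
Lemma integral_frac_denominator (D : idomainType) (r b : D) : b != 0 ->
    integralOver (@FracField.tofrac D) (tofrac r / tofrac b) ->
  exists k, forall n, exists t, b ^+ k * r ^+ n = t * b ^+ n.
Proof.
move=> b0 [p mp rp]; exists (size p) => n.
have b0' : tofrac b != 0 :> {fraction D} by rewrite tofrac_eq0.
pose h := Pdiv.Ring.rmodp 'X^n p.
have sh : (size h <= size p)%N.
  by apply: ltnW; rewrite Pdiv.Ring.ltn_rmodp monic_neq0.
exists (\sum_(i < size h) h`_i * r ^+ i * b ^+ (size p - i)).
apply/eqP; rewrite -tofrac_eq; apply/eqP.
rewrite !rmorphM /= !rmorphXn /= rmorph_sum /= mulr_suml.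
have zn : (tofrac r / tofrac b) ^+ n =
    (map_poly (@FracField.tofrac D) h).[tofrac r / tofrac b].
  have := congr1 (fun q => (map_poly (@FracField.tofrac D) q).[tofrac r / tofrac b])
    (Pdiv.RingMonic.rdivp_eq mp 'X^n).
  rewrite map_polyXn hornerXn => ->.
  by rewrite rmorphD rmorphM hornerD hornerM (rootP rp) mulr0 add0r.
have -> : tofrac r ^+ n = (tofrac r / tofrac b) ^+ n * tofrac b ^+ n.
  by rewrite expr_div_n divfK // expf_neq0.
rewrite zn (@horner_coef_wide _ (size h)) ?size_poly //.
rewrite mulrA mulr_sumr mulr_suml; apply: eq_bigr => i _; congr (_ * _).
rewrite !rmorphM /= !rmorphXn /= coef_map /= expr_div_n.
have ip : (i <= size p)%N by apply: leq_trans (ltnW (ltn_ord i)) sh.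
rewrite -{1}(subnK ip) exprD [LHS]mulrC -!mulrA; congr (_ * (_ * _)).
by rewrite [_ ^+ (_ - _) * _]mulrC mulKf // expf_neq0.
Qed.

(** Write the element as [u / b] and divide [u] by [b]; only the remainder [r]
    matters. If [r] is nonzero, a common denominator of the powers of [r / b]
    shows, comparing leading monomials, that [n] times the exponent of a variable
    in that of [b] exceeds [n] times its exponent in that of [r] by at most a
    constant, for all [n]. So the leading monomial of [b] divides that of [r],
    which division excludes. *)
Lemma ps_integrally_closed (z : {fraction S}) :
  integralOver (@FracField.tofrac S) z -> exists a, z = tofrac a.
Proof.
have [u [b [b0 ->]]] := frac_div z => int_z.
have [m lb] := lead_exists b0; have [q [r [uE r0]]] := ps_division lb u.
have b0' : tofrac b != 0 :> {fraction S} by rewrite tofrac_eq0.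
have zE : tofrac u / tofrac b = tofrac q + tofrac r / tofrac b.
  by rewrite uE rmorphD rmorphM /= mulrDl mulfK.
have [req|rN0] := eqVneq r 0.
  by exists q; rewrite zE req tofrac0 mul0r addr0.
have [n ln] := lead_exists rN0; case/negP: (ln.1); apply/eqP/r0.
have [|k kP] := @integral_frac_denominator _ r b b0.
  have -> : tofrac r / tofrac b = tofrac u / tofrac b - tofrac q.
    by rewrite zE addrC addKr.
  have int_q := integral_id (@FracField.tofrac S : {rmorphism S -> {fraction S}}) q.
  exact: integral_sub int_z int_q.
apply/msubsetP => i; rewrite leqNgt; apply/negP => nm.
(* With this exponent the constant [k * m i] is outweighed. *)
have [t tE] := kP (k * m i).+1.
have t0 : t != 0.
  by apply: contraNneq (mulf_neq0 (expf_neq0 k b0) (expf_neq0 (k * m i).+1 rN0));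
    rewrite tE => ->; rewrite mul0r.
have [l lt] := lead_exists t0.
have := lead_uniq (leadM (leadXn k lb) (leadXn (k * m i).+1 ln)).
rewrite tE => /(_ _ (leadM lt (leadXn (k * m i).+1 lb))) /msetP /(_ i).
rewrite !msetE2 !mset_mulnE; nia.
Qed.

End IntegrallyClosed.

(** * Substitution of power series for the variables *)

Section Substitution.
Local Open Scope mset_scope.
Local Open Scope ring_scope.
Variables (K : fieldType) (I : choiceType).
Local Notation S := (powerseries K I).
Implicit Types (m n k : {mset I}) (s t : S).

Lemma perm_msetD m n : perm_eq (m `+` n) (m ++ n).
Proof.
apply/eq_seq_msetP; rewrite seq_mset_id; apply/msetP => i.
by rewrite mset_seqE count_cat !count_mem_mset msetE2.
Qed.

Section Image.
Variable y : I -> S.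

Definition monomial_image n : S := \prod_(i <- (n : seq I)) y i.

Definition image_support m : set {mset I} :=
  [set n | monomial_image n m != 0]%classic.

(** The image of [s] when each [X_i] is replaced by [y i]. It is meaningful when
    every monomial occurs in the images of only finitely many monomials. *)
Definition subst s : S :=
  fun m => \sum_(n \in image_support m) s n * monomial_image n m.

Lemma monomial_image0 : monomial_image mset0 = 1.
Proof. by rewrite /monomial_image enum_mset0 big_nil. Qed.

Lemma monomial_imageD m n :
  monomial_image (m `+` n) = monomial_image m * monomial_image n.
Proof.
by rewrite /monomial_image -big_cat; apply: perm_big; apply: perm_msetD.
Qed.

Lemma monomial_imagen i d : monomial_image (msetn d i) = y i ^+ d.
Proof. by rewrite /monomial_image enum_msetn big_nseq iter_mulr_1. Qed.

Hypothesis fin_support : forall m, finite_set (image_support m).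

Lemma substE (Z : set {mset I}) s m : finite_set Z ->
    (forall n, monomial_image n m != 0 -> s n != 0 -> Z n) ->
  subst s m = \sum_(n \in Z) s n * monomial_image n m.
Proof.
move=> finZ supZ; rewrite /subst.
rewrite (fsbig_widen _ (image_support m `|` Z)%classic); last 2 first.
- by move=> n; left.
- by move=> n [_ /= /negP/negPn/eqP ->]; rewrite mulr0.
rewrite [RHS](fsbig_widen _ (image_support m `|` Z)%classic) //.
move=> n [_ nZ] /=; apply: contra_notP nZ => /eqP.
by rewrite mulf_eq0 negb_or => /andP[sn yn]; apply: supZ.
Qed.

Lemma substD s t : subst (s + t) = subst s + subst t.
Proof.
apply/funext => m; rewrite psDE /subst -fsbig_split //=.
by apply: eq_fsbigr => n _; rewrite psDE mulrDl.
Qed.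

Lemma substZ c s : subst (c *: s) = c *: subst s.
Proof.
apply/funext => m; rewrite [RHS]mulr_fsumr.
by apply: eq_fsbigr => n _; rewrite -mulrA.
Qed.

Lemma subst_monomial n : subst (monomial K n) = monomial_image n.
Proof.
apply/funext => m; rewrite (@substE [set n]%classic) //.
- by rewrite fsbig_set1 /monomial eqxx mul1r.
- by move=> k _; rewrite /monomial /=; case: (eqVneq k n) => // _; rewrite eqxx.
Qed.

(** Both sides sum [T a b] over pairs of monomials; the pairs that contribute to
    the coefficient of [m] have both components in the finite set [Z] of monomials
    whose image contains a divisor of [m]. *)
Lemma substM s t : subst (s * t) = subst s * subst t.
Proof.
apply/funext => m; pose Z := (\bigcup_(k in submsets m) image_support k)%classic.
have finZ : finite_set Z by apply: bigcup_finite => //; apply: finite_submsets.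
pose W := [set msetD a b | a in Z & b in Z]%classic.
have finW : finite_set W by apply: finite_image2.
have ZP a b : monomial_image (a `+` b) m != 0 -> Z a /\ Z b.
  rewrite monomial_imageD => /psM_neq0[k km /andP[ak bk]].
  split; first by exists k.
  by exists (m `\` k) => //; apply: msubsetDl.
pose T a b := s a * t b * monomial_image (a `+` b) m.
transitivity (\sum_(a \in Z) \sum_(b \in Z) T a b).
  rewrite (@substE W) //; last first.
    move=> n Yn _; have [|Z0 Zn] := ZP mset0 n; first by rewrite mset0D.
    by exists mset0 => //; exists n => //; rewrite mset0D.
  transitivity (\sum_(n \in W) \sum_(a \in Z)
      if a \in submsets n then T a (n `\` a) else 0).
    apply: eq_fsbigr => n _; rewrite psME mulr_fsuml -fsbig_mkcondr.
    rewrite -[in LHS](fsbig_widen (Z `&` submsets n)%classic).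
    - apply: eq_fsbigr => a /set_mem[_ an]; rewrite /T msetBDKC //.
    - by move=> a [].
    - move=> a [/= an nZa]; apply/eqP; rewrite mulf_eq0; apply/orP; right.
      apply: contra_notT nZa => Yn.
      by have [] := ZP a (n `\` a); rewrite ?msetBDKC.
  rewrite exchange_fsbig //; apply: eq_fsbigr => a /set_mem Za.
  transitivity (\sum_(n \in W)
      if n \in [set n | (a `<=` n)%mset]%classic then T a (n `\` a) else 0).
    by apply: eq_fsbigr => n _; congr (if _ then _ else _); apply/idP/idP;
      rewrite !inE.
  rewrite -fsbig_mkcondr -(fsbig_widen (msetD a @` Z)%classic).
  - rewrite (reindex_fsbig (msetD a) Z) //.
      apply: eq_fsbigr => b _; congr (T a _).
      by apply/msetP => i; rewrite !msetE2 addKn.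
    apply: inj_bij => b c _ _ /msetP e; apply/msetP => i.
    by have := e i; rewrite !msetE2 => /addnI.
  - move=> _ [b Zb <-]; split; first by exists a => //; exists b.
    by apply/msubsetP => i; rewrite msetE2 leq_addr.
  - move=> n [[_ /= an] nZ]; apply/eqP; rewrite mulf_eq0 msetBDKC //.
    apply/orP; right; apply: contra_notT nZ => Yn.
    exists (n `\` a); last by rewrite msetBDKC.
    by have [] := ZP a (n `\` a); rewrite ?msetBDKC.
transitivity (\sum_(k \in submsets m) \sum_(a \in Z) \sum_(b \in Z)
    s a * t b * (monomial_image a k * monomial_image b (m `\` k))).
  have fin_m := finite_submsets m.
  rewrite [RHS]exchange_fsbig //.
  apply: eq_fsbigr => a _; rewrite [RHS]exchange_fsbig //.
  by apply: eq_fsbigr => b _; rewrite /T monomial_imageD psME mulr_fsumr.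
rewrite psME; apply: eq_fsbigr => k /set_mem km.
rewrite (@substE Z s) //; last by move=> a Ya _; exists k.
rewrite (@substE Z t) //; last first.
  by move=> b Yb _; exists (m `\` k) => //; apply: msubsetDl.
rewrite mulr_fsuml; apply: eq_fsbigr => a _.
by rewrite mulr_fsumr; apply: eq_fsbigr => b _; rewrite mulrACA.
Qed.

Lemma subst_rmorphism : exists f : {rmorphism S -> S}, forall s, f s = subst s.
Proof.
have subB : zmod_morphism subst.
  by move=> s t; rewrite substD -scaleN1r substZ scaleN1r.
have subM : monoid_morphism subst.
  by split; [rewrite -monomial0 subst_monomial monomial_image0|exact: substM].
by exists (HB.pack_for {rmorphism S -> S} subst (GRing.isZmodMorphism.Build _ _ _ subB)
                        (GRing.isMonoidMorphism.Build _ _ _ subM)).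
Qed.

End Image.

(** Two substitutions compose to the identity if they do so on variables:
    [subst z] is multiplicative, hence the image of each monomial is right, and
    the sum over monomials can be exchanged with [subst z] by local finiteness. *)
Lemma subst_comp (y z : I -> S)
    (fin_y : forall m, finite_set (image_support y m))
    (fin_z : forall m, finite_set (image_support z m)) :
  (forall i, subst z (y i) = monomial K (msetn 1 i)) ->
  forall s, subst z (subst y s) = s.
Proof.
move=> zy s; apply/funext => m.
have zyn n : subst z (monomial_image y n) = monomial K n.
  have [f fE] := subst_rmorphism fin_z.
  rewrite -fE rmorph_prod.
  under eq_bigr do rewrite fE zy.
  transitivity (monomial K (\big[@msetD I/mset0]_(i <- (n : seq I)) msetn 1 i)).
    by apply/esym/big_morph => // a b; rewrite monomialM.
  congr (monomial K _); apply/msetP => i; rewrite -[RHS]count_mem_mset.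
  elim: (n : seq I) => [|j l IHl]; first by rewrite big_nil mset0E.
  by rewrite big_cons msetE2 IHl msetnE /= eq_sym; case: eqP.
(* The singleton [m] keeps the one surviving term in the range of the sum. *)
pose Z := ((\bigcup_(n in image_support z m) image_support y n) `|` [set m])%classic.
have finZ : finite_set Z.
  by rewrite finite_setU; split=> //; apply: bigcup_finite.
rewrite /subst; transitivity (\sum_(n \in image_support z m) \sum_(a \in Z)
    s a * (monomial_image y a n * monomial_image z n m)).
  apply: eq_fsbigr => n /set_mem nm.
  rewrite -[X in X * _]/(subst y s n) (@substE _ Z) //.
    by rewrite mulr_fsuml; apply: eq_fsbigr => a _; rewrite mulrA.
  by move=> a Ya _; left; exists n.
rewrite exchange_fsbig //; transitivity (\sum_(a \in Z) s a * monomial K a m).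
  by apply: eq_fsbigr => a _; rewrite -mulr_fsumr -zyn.
rewrite -(fsbig_widen [set m]%classic).
- by rewrite fsbig_set1 /monomial eqxx mulr1.
- by move=> _ ->; right.
- move=> a [_ /= am]; rewrite /monomial.
  by case: eqVneq am => [->//|_ _]; rewrite mulr0.
Qed.

End Substitution.

(** * Automorphisms that lower the leading monomial *)

Section Retraction.
Local Open Scope mset_scope.
Local Open Scope ring_scope.
Variables (K : fieldType) (I : choiceType) (j : I).
Local Notation S := (powerseries K I).
Implicit Types (m n k : {mset I}) (s t : S).

(** The endomorphism [X_j |-> 0], a retraction onto the series without [X_j]. *)
Definition kill_var s : S := fun n => if n j == 0%N then s n else 0.

Lemma kill_var_zmod : zmod_morphism kill_var.
Proof.
by move=> s t; apply/funext => n; rewrite psBE /kill_var; case: ifP; rewrite ?subr0.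
Qed.

Lemma kill_var_monoid : monoid_morphism kill_var.
Proof.
split=> [|s t]; apply/funext => n; rewrite /kill_var.
  rewrite -monomial0 /monomial; case: (eqVneq n mset0) => [->|_].
    by rewrite mset0E.
  by case: ifP.
rewrite [RHS]psME; case: eqP => [nj|/eqP nj].
  rewrite psME; apply: eq_fsbigr => k /set_mem /= /msubsetP kn.
  have kj : k j = 0%N by have := kn j; rewrite nj leqn0 => /eqP.
  by rewrite msetE2 nj kj.
rewrite fsbig1 // => k /msubsetP kn.
case: eqP => [kj|_]; last by rewrite mul0r.
by rewrite msetE2 kj subn0 (negPf nj) mulr0.
Qed.

HB.instance Definition _ :=
  GRing.isZmodMorphism.Build S S kill_var kill_var_zmod.
HB.instance Definition _ :=
  GRing.isMonoidMorphism.Build S S kill_var kill_var_monoid.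

Lemma kill_varE s n : n j = 0%N -> kill_var s n = s n.
Proof. by rewrite /kill_var => ->. Qed.

Lemma kill_var_monomial n :
  kill_var (monomial K n) = if n j == 0%N then monomial K n else 0.
Proof.
apply/funext => k; rewrite /kill_var /monomial.
case: (eqVneq k n) => [->|kn]; first by case: ifP => _; rewrite ?eqxx.
by case: ifP => _; case: ifP => //; rewrite (negPf kn).
Qed.

End Retraction.

Section Shear.
Local Open Scope mset_scope.
Local Open Scope ring_scope.
Variables (K : fieldType) (I : choiceType) (x j : I) (N : nat).
Hypotheses (xj : x != j) (N0 : (0 < N)%N).
Local Notation S := (powerseries K I).
Implicit Types (m n k : {mset I}) (s t : S) (c : K).

Definition var i : S := monomial K (msetn 1 i).

(** The values at the variables of [X_j |-> X_j + c X_x ^ N]. *)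
Definition shear_var c i : S := var i + (if i == j then c *: var x ^+ N else 0).

Lemma var_coef i n : var i n != 0 -> n = msetn 1 i.
Proof. by rewrite /var /monomial; case: (eqVneq n) => // _; rewrite eqxx. Qed.

Lemma varXn i d : var i ^+ d = monomial K (msetn d i).
Proof.
rewrite monomialXn; congr monomial; apply/msetP => l.
by rewrite mset_mulnE !msetnE; case: eqP; rewrite ?muln1 ?muln0.
Qed.

Lemma shear_var_coef c i n : shear_var c i n != 0 ->
  forall l, ((l == i) <= n l + (if l == j then n x else 0))%N.
Proof.
rewrite /shear_var psDE => n0 l; have [li|//] := eqVneq l i.
have [|vi0] := eqVneq (var i n) 0; last first.
  by rewrite (var_coef vi0) li msetnxx.
move=> vi0; move: n0; rewrite vi0 add0r.
case: (eqVneq i j) => [ij|_]; last by rewrite eqxx.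
rewrite varXn => nN; have -> : n = msetn N x.
  apply/eqP; apply: contraNT nN => /negPf nN.
  by rewrite -[_ n]/(c * monomial K (msetn N x) n) /monomial nN mulr0.
by rewrite li ij eqxx msetnxx; lia.
Qed.

(** Local finiteness of the shear: as [N] is positive, each factor [X_j] leaves
    behind at least one [X_j] or one [X_x]. *)
Lemma shear_image_coef c n m : monomial_image (shear_var c) n m != 0 ->
  n `<=` m `+` msetn (m x) j.
Proof.
move=> nm; apply/msubsetP => l; rewrite msetE2 msetnE -count_mem_mset.
move: nm; rewrite /monomial_image; elim: (n : seq I) m => [//|i r IHr] m.
rewrite big_cons => /psM_neq0[k /msubsetP km /andP[/shear_var_coef/(_ l) ik /IHr]].
have := km l; have := km x; rewrite !msetE2 /= [i == l]eq_sym.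
move: (k l) (k x) (m l) (m x) (count_mem l r) ik => a b a' b' d.
by do !case: (_ == _) => /=; lia.
Qed.

Lemma shear_fin c m : finite_set (image_support (shear_var c) m).
Proof.
apply: sub_finite_set (finite_submsets (m `+` msetn (m x) j)).
by move=> n; apply: shear_image_coef.
Qed.

Lemma shear_fixed c i : i != j -> shear_var c i = var i.
Proof. by rewrite /shear_var => /negPf ->; rewrite addr0. Qed.

Lemma shearK c s : subst (shear_var c) (subst (shear_var (- c)) s) = s.
Proof.
apply: subst_comp => [||i]; try exact: shear_fin.
have [f fE] := subst_rmorphism (shear_fin c).
have fvar i' : f (var i') = shear_var c i'.
  by rewrite fE subst_monomial ?monomial_imagen //; exact: shear_fin.
rewrite -fE; have [->|ij] := eqVneq i j; last first.
  by rewrite shear_fixed // fvar shear_fixed.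
have -> : shear_var (- c) j = var j - c *: var x ^+ N.
  by rewrite /shear_var eqxx scaleNr.
have fZ t : f (c *: t) = c *: f t by rewrite !fE substZ.
have fx : f (var x ^+ N) = var x ^+ N.
  by rewrite rmorphXn /= (fvar x) shear_fixed.
transitivity (f (var j) - f (c *: var x ^+ N)); first exact: rmorphB.
by rewrite [f (c *: _)]fZ fx (fvar j) /shear_var eqxx addrK.
Qed.

(** Modulo [X_j], the image of the monomial [n] is the monomial obtained by
    replacing [X_j] by [X_x ^ N]. *)
Lemma kill_shear_image n : exists2 m,
  kill_var j (monomial_image (shear_var 1) n) = monomial K m &
  forall i, m i = ((if i == j then 0 else n i) + (if i == x then N * n j else 0))%N.
Proof.
have [m mE mi] : exists2 m,
    kill_var j (\prod_(i <- (n : seq I)) shear_var 1 i) = monomial K m &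
    forall i, m i = ((if i == j then 0 else count_mem i (n : seq I)) +
                     (if i == x then N * count_mem j (n : seq I) else 0))%N.
  elim: (n : seq I) => [|i r [m mE mi]].
    exists mset0; first by rewrite big_nil rmorph1.
    by move=> i; rewrite mset0E /= muln0 !if_same.
  exists (m `+` (if i == j then msetn N x else msetn 1 i)).
    rewrite big_cons rmorphM /= mE msetDC -monomialM; congr (_ * _).
    have [->|ij] := eqVneq i j; last first.
      by rewrite shear_fixed // kill_var_monomial msetnE [j == i]eq_sym (negPf ij).
    have -> : shear_var 1 j = var j + monomial K (msetn N x).
      by rewrite /shear_var eqxx scale1r varXn.
    have kj : kill_var j (var j) = 0 by rewrite kill_var_monomial msetnxx.
    have kx : kill_var j (monomial K (msetn N x)) = monomial K (msetn N x).
      by rewrite kill_var_monomial msetnE [j == x]eq_sym (negPf xj).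
    exact: etrans (rmorphD _ _ _) (etrans (congr2 +%R kj kx) (add0r _)).
  move=> l; rewrite msetE2 mi /= [i == l]eq_sym.
  have [ij|ij] := eqVneq i j; rewrite msetnE.
    rewrite ij; have [->|_] := eqVneq l j; first by rewrite [j == x]eq_sym (negPf xj).
    by case: (l == x); lia.
  have [->|_] := eqVneq l j.
    by rewrite [j == i]eq_sym (negPf ij) [j == x]eq_sym (negPf xj).
  by case: (l == x); case: (l == i); lia.
by exists m => // i; rewrite mi !count_mem_mset.
Qed.

(** Let [w] be the monomial obtained from [v] by replacing [X_j] by [X_x ^ N].
    It is smaller than [v] because [X_j] is gone. Its coefficient in the image of
    [s] collects the terms of [s] at the monomials [n] that become [w] in the same
    way: such an [n] agrees with [v] outside [x] and [j], and satisfies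
    [n x + N * n j = v x + N * v j]. As [v x < N], the exponent [n j] is at most
    [v j]; if it is less, then [n] is smaller than [v] and does not occur in [s].
    So only [n = v] contributes and the coefficient is nonzero. *)
Lemma shear_lead s v : var_lt x j -> lead s v -> v j != 0%N -> (v x < N)%N ->
  exists2 m, mon_lt m v & lead (subst (shear_var 1) s) m.
Proof.
move=> ltxj ls vj vx; have [w wE wi] := kill_shear_image v.
have wj : w j = 0%N by rewrite wi eqxx eq_sym (negPf xj).
have sw : subst (shear_var 1) s w = s v.
  rewrite (@substE _ _ _ [set v]%classic) //.
    by rewrite fsbig_set1 -(kill_varE _ wj) wE /monomial eqxx mulr1.
  move=> n; rewrite -(kill_varE _ wj) => nw sn /=.
  have [w' w'E w'i] := kill_shear_image n.
  have eww' : w = w'.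
    move: nw; rewrite w'E /monomial; case: (eqVneq w w') => // _.
    by rewrite eqxx.
  have rest i : i != j -> i != x -> n i = v i.
    move=> /negPf ij /negPf ix; have := w'i i; have := wi i.
    by rewrite eww' ij ix !addn0 => -> ->.
  have top : (n x + N * n j = v x + N * v j)%N.
    have := w'i x; have := wi x; rewrite eww' eqxx (negPf xj) => -> //.
  have [nvj|nvj|nvj] := ltngtP (n j) (v j).
  - case/negP: sn; apply/eqP/ls.2; exists j => // i ji; apply: rest.
      by apply: contraTneq ji => ->; rewrite var_ltxx.
    by apply: contraTneq (var_lt_trans ltxj ji) => ->; rewrite var_ltxx.
  - by nia.
  - apply/msetP => i; have [->//|ij] := eqVneq i j.
    by have [->|ix] := eqVneq i x; [move: top; rewrite nvj; lia|exact: rest].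
have [|m lm] := @lead_exists _ _ (subst (shear_var 1) s).
  by apply: contraNneq (ls.1) => s0; rewrite -sw s0.
exists m => //; have wv : mon_lt w v.
  exists j; first by rewrite wj lt0n.
  move=> i ji; rewrite wi; have /negPf -> : i != j.
    by apply: contraTneq ji => ->; rewrite var_ltxx.
  have /negPf -> : i != x.
    by apply: contraTneq (var_lt_trans ltxj ji) => ->; rewrite var_ltxx.
  by rewrite addn0.
have [|->//|mw] := @lead_min _ _ _ _ w lm.
  by rewrite sw (ls.1).
exact: mon_lt_trans mw wv.
Qed.

End Shear.

Lemma exists_lead_lowering (K : fieldType) (I : choiceType)
    (s : powerseries K I) (v : {mset I}%mset) (x j : I) :
    var_lt x j -> lead s v -> v j != 0%N ->
  exists f : {rmorphism powerseries K I -> powerseries K I},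
    bijective f /\ exists2 m, mon_lt m v & lead (f s) m.
Proof.
move=> ltxj ls vj; have xj : x != j by case/andP: ltxj.
have N0 : (0 < (v x).+1)%N by [].
have [f fE] := subst_rmorphism (shear_fin xj N0 (1 : K)).
exists f; split.
  exists (subst (shear_var x j (v x).+1 (- 1 : K))) => t; rewrite fE.
    by have := shearK xj N0 (- 1) t; rewrite opprK.
  exact: shearK.
by rewrite fE; apply: shear_lead.
Qed.

(** * Monic factors over an integrally closed domain *)

Section SplittingField.

Lemma irreducible_factor (F : fieldType) (p : {poly F}) : (1 < size p)%N ->
  exists2 q, irreducible_poly q & q %| p.
Proof.
have [n] := ubnP (size p); elim: n p => // n IHn p pn p1.
have [irr|nirr] := pselect (irreducible_poly p); first by exists p.
have [d [d1 dp ndp]] : exists d : {poly F}, [/\ size d != 1%N, d %| p & ~~ (d %= p)].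
  apply: contrapT => nex; apply: nirr; split=> // d d1 dp.
  by apply: contrapT => /negP ndp; apply: nex; exists d.
have p0 : p != 0 by rewrite -size_poly_gt0 (ltn_trans _ p1).
have d0 : d != 0 by apply: contraNneq p0 => d0; rewrite -dvd0p -d0.
have dltp : (size d < size p)%N.
  by rewrite ltn_neqAle (dvdp_size_eqp dp) ndp dvdp_leq.
have d_gt1 : (1 < size d)%N by rewrite ltn_neqAle eq_sym d1 size_poly_gt0.
have [q irrq qd] := IHn d (leq_trans dltp pn) d_gt1.
by exists q => //; apply: dvdp_trans qd dp.
Qed.

(** Adjoin a root of an irreducible factor, divide by the linear factor it gives,
    and repeat. *)
Lemma monic_splits (F : fieldType) (p : {poly F}) : p \is monic ->
  exists (L : fieldType) (f : {rmorphism F -> L}) (zs : seq L),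
    map_poly f p = \prod_(z <- zs) ('X - z%:P).
Proof.
have [n] := ubnP (size p); elim: n F p => // n IHn F p pn mp.
have [p1|p_gt1] := leqP (size p) 1.
  exists F, idfun, [::]; rewrite big_nil map_poly_id //.
  move: mp; rewrite (size1_polyC p1) monicE lead_coefC => /eqP ->.
  by rewrite polyC1.
have [q irrq qp] := irreducible_factor p_gt1.
have [L _ [z qz _]] := irredp_FAdjoin irrq.
have pz : root (map_poly (in_alg L) p) z.
  by rewrite -(divpK qp) rmorphM rootM qz orbT.
have [p' p'E] := factor_theorem _ _ pz.
have mp' : p' \is monic by rewrite -(monicMr _ (monicXsubC z)) -p'E map_monic.
have sp' : (size p' < n)%N.
  rewrite -ltnS (leq_trans _ pn) // ltnS -(size_map_poly (in_alg L)) p'E.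
  by rewrite size_Mmonic ?monicXsubC ?monic_neq0 // size_XsubC addn2.
have [L' [f [zs fE]]] := IHn _ _ sp' mp'.
exists L', (f \o in_alg L), (f z :: zs).
by rewrite map_poly_comp p'E rmorphM /= fE big_cons mulrC map_polyXsubC.
Qed.

End SplittingField.

Section IntegrallyClosedGauss.

Lemma integral_coef_prod_XsubC (R : comNzRingType) (L : fieldType)
    (f : {rmorphism R -> L}) (zs : seq L) :
    (forall z, z \in zs -> integralOver f z) ->
  forall i, integralOver f (\prod_(z <- zs) ('X - z%:P))`_i.
Proof.
elim: zs => [|z zs IHzs] int_zs i.
  by rewrite big_nil coef1; case: eqP => _; [apply: integral1|apply: integral0].
have IH : forall i, integralOver f (\prod_(z <- zs) ('X - z%:P))`_i.
  by apply: IHzs => w wzs; apply: int_zs; rewrite inE wzs orbT.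
rewrite big_cons mulrBl coefB coefXM coefCM.
apply: integral_sub; first by case: eqP => _ //; apply: integral0.
by apply: integral_mul => //; apply: int_zs; rewrite mem_head.
Qed.

Variables (D : idomainType) (F : fieldType) (iota : {rmorphism D -> F}).
Hypothesis iota_inj : injective iota.
Hypothesis closedD : forall z : F, integralOver iota z -> exists a, z = iota a.

(** Over a splitting field of [A] the coefficients of [A] are polynomials in its
    roots, which are roots of [p] and so integral over [D]; being in the fraction
    field, they lie in [D]. *)
Lemma monic_dvdp_integral (p : {poly D}) (A : {poly F}) : p \is monic ->
  A \is monic -> A %| map_poly iota p ->
  exists2 A0 : {poly D}, A0 \is monic & A = map_poly iota A0.
Proof.
move=> mp mA Ap; have [L [f [zs fA]]] := monic_splits mA.
have int_zs z : z \in zs -> integralOver (f \o iota : {rmorphism D -> L}) z.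
  move=> zzs; exists p => //; rewrite map_poly_comp.
  apply: (root_dvdp (_ : map_poly f A %| _)); first by rewrite dvdp_map.
  by rewrite fA root_prod_XsubC.
have int_A i : integralOver iota A`_i.
  have := integral_coef_prod_XsubC int_zs i; rewrite -fA coef_map.
  by move=> [q mq qA]; exists q => //; move: qA; rewrite map_poly_comp fmorph_root.
have /choice[a aE] : forall i, exists a, A`_i = iota a by move=> i; apply: closedD.
have AE : A = map_poly iota (\poly_(i < size A) a i).
  apply/polyP => i; rewrite coef_map coef_poly; case: ltnP => [_|Ai].
    exact: aE.
  by rewrite nth_default ?raddf0.
exists (\poly_(i < size A) a i) => //.
rewrite monicE -(inj_eq iota_inj) rmorph1.
by rewrite -lead_coef_map_inj ?rmorph0 // -AE -monicE.
Qed.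

Lemma monic_irreducible_frac (p : {poly D}) : p \is monic -> (1 < size p)%N ->
    (forall A B, A \is monic -> B \is monic -> A * B = p ->
       size A = 1%N \/ size B = 1%N) ->
  irreducible_poly (map_poly iota p).
Proof.
move=> mp p_gt1 irr_p.
have size_iota q : size (map_poly iota q) = size q.
  by apply: size_map_inj_poly => //; rewrite raddf0.
have mp' : map_poly iota p \is monic by apply: monic_map.
split=> [|A A1 Ap]; first by rewrite size_iota.
have A0 : A != 0 by apply: dvdpN0 Ap _; apply: monic_neq0.
have lA0 : lead_coef A != 0 by rewrite lead_coef_eq0.
have : (lead_coef A)^-1 *: A %= A by apply: eqp_scale; rewrite invr_eq0.
have : (lead_coef A)^-1 *: A \is monic by rewrite monicE lead_coefZ mulVf.
move: (_ *: A) => A' mA' A'A.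
have A'p : A' %| map_poly iota p by rewrite (eqp_dvdl _ A'A).
have [B pAB] : exists B, map_poly iota p = A' * B.
  by exists (map_poly iota p %/ A'); rewrite mulrC divpK.
have mB : B \is monic by move: mp'; rewrite pAB monicMl.
have Bp : B %| map_poly iota p by rewrite pAB dvdp_mull.
have [A0' mA0 A0E] := monic_dvdp_integral mp mA' A'p.
have [B0' mB0 B0E] := monic_dvdp_integral mp mB Bp.
have AB : A0' * B0' = p.
  by apply: (map_inj_poly iota_inj); rewrite ?raddf0 // rmorphM /= -A0E -B0E.
have [sA|sB] := irr_p _ _ mA0 mB0 AB.
  by case/negP: A1; rewrite -(eqp_size A'A) A0E size_iota sA.
rewrite -(eqp_ltrans A'A) pAB.
have B1 : (size B <= 1)%N by rewrite B0E size_iota sB.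
move: mB; rewrite (size1_polyC B1) monicE lead_coefC => /eqP ->.
by rewrite polyC1 mulr1 eqpxx.
Qed.

(** Over the fraction field irreducible polynomials are prime, and [p] divides no
    nonzero polynomial of smaller degree. *)
Lemma irreducible_frac_mul (p q r1 r2 : {poly D}) :
    irreducible_poly (map_poly iota p) -> r1 * r2 = q * p ->
    (size r1 < size p)%N -> (size r2 < size p)%N ->
  r1 = 0 \/ r2 = 0.
Proof.
move=> irrp r12 r1p r2p.
have size_iota q' : size (map_poly iota q') = size q'.
  by apply: size_map_inj_poly => //; rewrite raddf0.
have small (r : {poly D}) : (size r < size p)%N ->
    map_poly iota p %| map_poly iota r -> r = 0.
  move=> rp pr; apply/eqP; apply: contraTT rp => r0; rewrite -leqNgt.
  by rewrite -!size_iota dvdp_leq // -size_poly_eq0 size_iota size_poly_eq0.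
have pr12 : map_poly iota p %| map_poly iota r1 * map_poly iota r2.
  by rewrite -rmorphM r12 rmorphM dvdp_mull.
have [g1|gp] := irredp_XsubCP irrp (dvdp_gcdl _ (map_poly iota r1)).
  right; apply: small => //.
  rewrite -(Gauss_dvdpr _ (_ : coprimep _ (map_poly iota r1))) //.
  by rewrite /coprimep (eqp_size g1) size_poly1.
by left; apply: small => //; rewrite -(eqp_dvdl _ gp) dvdp_gcdr.
Qed.

End IntegrallyClosedGauss.

(** * Weierstrass preparation *)

Section RingDivisibility.
Variable R : comPzRingType.

Definition rdvd (a b : R) := exists c, b = c * a.

Definition rprime (a : R) :=
  forall b c, rdvd a (b * c) -> rdvd a b \/ rdvd a c.

Lemma rdvd_trans a b c : rdvd a b -> rdvd b c -> rdvd a c.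
Proof. by move=> [u ->] [w ->]; exists (w * u); rewrite mulrA. Qed.

End RingDivisibility.

Section WeierstrassPolynomials.
Local Open Scope mset_scope.
Local Open Scope ring_scope.
Variables (K : fieldType) (I : choiceType) (x : I).
Local Notation S := (powerseries K I).
Local Notation X := (var K x).
Local Notation kill := (kill_var x).
Implicit Types (m n k : {mset I}) (s t : S) (p q r : {poly S}).

Definition const_coef s : K := s mset0.

Lemma const_coef_zmod : zmod_morphism const_coef.
Proof. by []. Qed.

Lemma const_coef_monoid : monoid_morphism const_coef.
Proof.
split; last exact: psM_coef0.
by rewrite /const_coef -monomial0 /monomial eqxx.
Qed.

HB.instance Definition _ :=
  GRing.isZmodMorphism.Build S K const_coef const_coef_zmod.
HB.instance Definition _ :=
  GRing.isMonoidMorphism.Build S K const_coef const_coef_monoid.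

(** Expressed as invariance under the retraction [kill] so that any identity of
    polynomials over the whole ring can be pushed, by applying [kill] to its
    coefficients, to one between polynomials of this kind. *)
Definition coefs_free_of_var p := map_poly kill p = p.

Lemma coefs_freeP p : coefs_free_of_var p <->
  forall i n, n x != 0%N -> p`_i n = 0.
Proof.
split=> [<- i n /negPf nx|p0]; first by rewrite coef_map /= /kill_var nx.
apply/polyP => i; rewrite coef_map; apply/funext => n; rewrite /= /kill_var.
by case: ifPn => // nx; rewrite p0.
Qed.

Lemma kill_var_idem s : kill (kill s) = kill s.
Proof. by apply/funext => n; rewrite /kill_var; case: (n x == 0%N). Qed.

Lemma coefs_free_map p : coefs_free_of_var (map_poly kill p).
Proof.
by rewrite /coefs_free_of_var -map_poly_comp; apply: eq_map_poly => s /=;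
  rewrite kill_var_idem.
Qed.

Lemma mulX_coef s n : (s * X) n = if n x == 0%N then 0 else s (n `\` msetn 1 x).
Proof.
rewrite mulrC; case: eqP => [nx|/eqP nx].
  rewrite monomialM_coef0 //; apply/msubsetP => /(_ x).
  by rewrite msetnxx nx.
have sub : msetn 1 x `<=` n.
  apply/msubsetP => i; rewrite msetnE; case: eqP => // ->.
  by rewrite lt0n.
by rewrite -{1}(msetBDKC sub) monomialM_coef.
Qed.

Lemma horner_coef_var p n : coefs_free_of_var p ->
  p.[X] n = p`_(n x) (n `\` msetn (n x) x).
Proof.
move=> /coefs_freeP; elim/poly_ind: p n => [|p c IHp] n p0.
  by rewrite horner0 coef0.
rewrite hornerMXaddC psDE mulX_coef coefD coefMX coefC.
have c0 k : k x != 0%N -> c k = 0.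
  by move=> kx; have := p0 0%N k kx; rewrite coefD coefMX coefC add0r.
case: eqP => [nx|/eqP nx]; first by rewrite !add0r nx msetn0 msetB0.
rewrite c0 // !addr0 IHp; last first.
  by move=> i k /(p0 i.+1); rewrite coefD coefMX coefC /= addr0.
rewrite !msetE2 msetnxx subn1; congr (p`_ _ _).
by apply/msetP => i; rewrite !msetE2 !msetnE; case: eqP => [->|_]; lia.
Qed.

Lemma horner_var_inj p : coefs_free_of_var p -> p.[X] = 0 -> p = 0.
Proof.
move=> pfree pX0; apply/polyP => i; rewrite coef0; apply/funext => n.
have [nx|nx] := eqVneq (n x) 0%N; last by move/coefs_freeP: pfree => ->.
have := congr1 (fun s : S => s (n `+` msetn i x)) pX0.
rewrite horner_coef_var // msetE2 nx msetnxx add0n; apply: etrans.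
by congr (p`_ _ _); apply/msetP => l; rewrite !msetE2 addnK.
Qed.

Lemma remainder_poly d s : (forall n, msetn d x `<=` n -> s n = 0) ->
  exists2 r, coefs_free_of_var r /\ (size r <= d)%N & r.[X] = s.
Proof.
move=> s0; pose r : {poly S} :=
  \poly_(i < d) ((fun n => if n x == 0%N then s (n `+` msetn i x) else 0) : S).
have rfree : coefs_free_of_var r.
  apply/coefs_freeP => i n /negPf nx; rewrite coef_poly.
  by case: ifP => // _; rewrite nx.
exists r; first by split=> //; apply: size_poly.
apply/funext => n; rewrite horner_coef_var // coef_poly.
case: ltnP => nd.
  rewrite !msetE2 msetnxx subnn eqxx; congr s; apply/msetP => i.
  by rewrite !msetE2 !msetnE; case: eqP => [->|_]; lia.
rewrite s0 //; apply/msubsetP => i; rewrite msetnE.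
by case: eqP => // ->.
Qed.

Lemma lead_var_pow d s n i : lead s (msetn d x) -> s n != 0 ->
  n `<=` msetn i x -> (d <= i)%N.
Proof.
move=> ls sn /msubsetP ni; have [nE|[l]] := lead_min ls sn.
  by have := ni x; rewrite -nE !msetnxx.
have := ni l; rewrite !msetnE; case: (eqVneq l x) => [->|_] nl ln _.
  by apply: leq_trans (ltnW ln) nl.
by move: (leq_trans ln nl).
Qed.

(** Divide [X ^+ d] by [s]: this gives [X ^+ d - t = u * s] with [t] a polynomial
    in [X] of degree less than [d]. As the powers of [X] below [d] do not occur in
    [s], those of [u * s] vanish as well, and the coefficient of [X ^+ d] shows
    that [u] has a nonzero constant coefficient. *)
Lemma weierstrass_preparation d s : lead s (msetn d x) ->
  exists p u, [/\ p \is monic, size p = d.+1, coefs_free_of_var p,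
    forall i, (i < d)%N -> const_coef p`_i = 0 &
    u \is a GRing.unit /\ p.[X] = u * s].
Proof.
move=> ls; have [u [t [XE t0]]] := ps_division ls (X ^+ d).
have [r [rfree rd] rX] := remainder_poly t0.
have pE : ('X^d - r).[X] = u * s.
  by rewrite hornerD hornerN hornerXn rX XE addrK.
have rlt : (size (- r) < size ('X^d : {poly S}))%N.
  by rewrite size_polyN size_polyXn ltnS.
have pfree : coefs_free_of_var ('X^d - r).
  by rewrite /coefs_free_of_var rmorphB /= map_polyXn rfree.
have us i : (i < d)%N -> (u * s) (msetn i x) = 0.
  move=> id; apply/eqP; apply: contraTT id => /psM_neq0[k ki /andP[_ sk]].
  by rewrite -leqNgt; apply: lead_var_pow ls sk _; apply: msubsetDl.
exists ('X^d - r), u; split=> //.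
- by rewrite monicE lead_coefDl // lead_coefXn.
- by rewrite size_polyDl // size_polyXn.
- move=> i id; rewrite -(us i id) -pE horner_coef_var // msetnxx.
  by rewrite msetBxx.
- split=> //; rewrite ps_unitE.
  have usd : (u * s) (msetn d x) = 1.
    have -> : u * s = X ^+ d - t by rewrite XE addrK.
    rewrite psBE t0 ?msubset_refl // subr0.
    by rewrite varXn /monomial eqxx.
  apply: contraTneq (oner_neq0 K) => u0; rewrite -usd negbK.
  rewrite (@psM_single _ _ _ _ _ mset0) ?u0 ?mul0r ?msub0set //.
  move=> k /msubsetP kd k0 _ sk; have dk : (d <= d - k x)%N.
    apply: lead_var_pow ls sk _; apply/msubsetP => i.
    by rewrite msetE2 !msetnE; case: eqP => [->|_]; rewrite ?leqnn.
  move/eqP: k0; apply; apply/msetP => i; have := kd i.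
  rewrite mset0E msetnE; case: eqP => [->|_]; lia.
Qed.

End WeierstrassPolynomials.

(** * Irreducible series with a pure power as leading monomial are prime *)

Lemma dvdp_Xn_size1 (F : fieldType) (A B : {poly F}) d :
  A * B = 'X^d -> A`_0 != 0 -> size A = 1%N.
Proof.
move=> ABE A0; have cop : coprimep A 'X^d.
  apply: coprimep_expr; rewrite -['X]subr0 -polyC0.
  by rewrite coprimep_XsubC rootE horner_coef0.
have Ad : A %| 'X^d by rewrite -ABE dvdp_mulr.
by move: cop => /(coprimep_dvdl Ad); rewrite coprimepp => /eqP.
Qed.

Section RegularCase.
Local Open Scope mset_scope.
Local Open Scope ring_scope.
Variables (K : fieldType) (I : choiceType) (x : I).
Local Notation S := (powerseries K I).
Local Notation X := (var K x).
Local Notation kill := (kill_var x).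
Local Notation iota := (@FracField.tofrac S).
Implicit Types (s t : S) (p q r : {poly S}).

Lemma weierstrass_division d p s : lead p.[X] (msetn d x) ->
  exists2 r, coefs_free_of_var x r /\ (size r <= d)%N & rdvd p.[X] (s - r.[X]).
Proof.
move=> lp; have [q [t [-> t0]]] := ps_division lp s.
have [r rP rX] := remainder_poly t0.
by exists r => //; exists q; rewrite rX addrK.
Qed.

(** The leading monomial of a nonzero multiple of [p.[X]] contains [X] to a power
    at least [d], and no monomial of [r.[X]] does. *)
Lemma weierstrass_remainder_uniq d p r : lead p.[X] (msetn d x) ->
  coefs_free_of_var x r -> (size r <= d)%N -> rdvd p.[X] r.[X] -> r = 0.
Proof.
move=> lp rfree rd [q rE]; apply: (horner_var_inj rfree); rewrite rE.
have [->|q0] := eqVneq q 0; first by rewrite mul0r.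
have [m lm] := lead_exists q0; have [+ _] := leadM lm lp.
rewrite -rE horner_coef_var // nth_default ?eqxx //.
by rewrite msetE2 msetnxx (leq_trans rd) ?leq_addl.
Qed.

(** A factorization of [p] over the fraction field consists, the ring being
    integrally closed, of monic polynomials over the ring itself. Applying [kill]
    to their coefficients and evaluating at [X] gives a factorization of [p.[X]],
    in which one factor must be a unit. Modulo the series without constant term
    [p] becomes ['X^d], whose only factors with nonzero constant term are
    constants; so the polynomial giving the unit has degree 0. *)
Lemma weierstrass_irreducible d p :
    p \is monic -> size p = d.+1 -> coefs_free_of_var x p ->
    (forall i, (i < d)%N -> const_coef p`_i = 0) ->
  rirreducible p.[X] -> irreducible_poly (map_poly iota p).
Proof.
move=> mp sp pfree p0 [pN0 pU pirr].
have pbar : map_poly (@const_coef K I) p = 'X^d.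
  apply/polyP => i; rewrite coef_map coefXn /=.
  have [id|di|->] := ltngtP i d; first exact: p0.
    by rewrite nth_default ?sp // raddf0.
  by have := monicP mp; rewrite lead_coefE sp => ->; rewrite rmorph1.
have unit_size1 A0 B0 : A0 \is monic -> A0 * B0 = p ->
    (map_poly kill A0).[X] \is a GRing.unit -> size A0 = 1%N.
  move=> mA AB; rewrite ps_unitE horner_coef_var; last exact: coefs_free_map.
  rewrite mset0E msetn0 msetB0 coef_map /= kill_varE ?mset0E // => A00.
  have mA' : map_poly (@const_coef K I) A0 \is monic by exact: monic_map.
  rewrite -(size_map_poly_id0 (f := @const_coef K I)); last first.
    by rewrite (monicP mA) rmorph1 oner_neq0.
  apply: (@dvdp_Xn_size1 _ _ (map_poly (@const_coef K I) B0) d).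
    by rewrite -pbar -AB rmorphM.
  by rewrite coef_map.
have d0 : (0 < d)%N.
  rewrite lt0n; apply: contraNneq pU => d0.
  move: mp; rewrite (size1_polyC (_ : size p <= 1)%N) ?sp ?d0 //.
  by rewrite monicE lead_coefC => /eqP ->; rewrite hornerC unitr1.
apply: (monic_irreducible_frac (@tofrac_inj S) (@ps_integrally_closed K I)) => //.
  by rewrite sp.
move=> A B mA mB AB.
have PAB : p.[X] = (map_poly kill A).[X] * (map_poly kill B).[X].
  by rewrite -hornerM -rmorphM AB /= pfree.
have [uA|uB] := pirr _ _ PAB; [left|right].
  exact: unit_size1 mA AB uA.
by apply: (unit_size1 _ A mB) => //; rewrite mulrC.
Qed.

(** Up to a unit [s] is [p.[X]] with [p] a Weierstrass polynomial. A product
    divisible by [p.[X]] can be reduced by Weierstrass division to a product of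
    polynomials of degree less than [d], which [p] divides by uniqueness of the
    remainder; [p] being prime over the fraction field, one of the two remainders
    is zero. *)
Lemma regular_irreducible_prime d s : lead s (msetn d x) ->
  rirreducible s -> rprime s.
Proof.
move=> ls irrs.
have [p [u [mp sp pfree p0 [uu pE]]]] := weierstrass_preparation ls.
have lp : lead p.[X] (msetn d x).
  rewrite pE -[msetn d x]mset0D; apply: leadM ls.
  by split; [rewrite -ps_unitE|move=> n [i]; rewrite mset0E].
have irrP : rirreducible p.[X].
  case: irrs => s0 sU sirr; split.
  - by rewrite pE mulf_neq0 //; apply: contraTneq uu => ->; rewrite unitr0.
  - by rewrite pE unitrM uu.
  - move=> b c; rewrite pE => /(congr1 ( *%R u^-1)); rewrite mulKr // mulrA.
    by move=> /sirr[]; [rewrite unitrM => /andP[]; left|right].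
have irrp := weierstrass_irreducible mp sp pfree p0 irrP.
have dvdPs : rdvd p.[X] s by exists u^-1; rewrite pE mulKr.
have dvdsP : rdvd s p.[X] by exists u.
suff primeP : rprime p.[X].
  move=> b c /(rdvd_trans dvdPs)/primeP.
  by move=> [] /(rdvd_trans dvdsP); [left|right].
move=> b c [e bcE].
have [r1 [r1free r1d] [q1 r1E]] := weierstrass_division b lp.
have [r2 [r2free r2d] [q2 r2E]] := weierstrass_division c lp.
have [q [r [r12 rfree rd]]] : exists q r, [/\ r1 * r2 = q * p + r,
    coefs_free_of_var x r & (size r <= d)%N].
  exists (map_poly kill (Pdiv.Ring.rdivp (r1 * r2) p)),
         (map_poly kill (Pdiv.Ring.rmodp (r1 * r2) p)); split.
  - have := congr1 (map_poly kill) (Pdiv.RingMonic.rdivp_eq mp (r1 * r2)).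
    by rewrite rmorphD !rmorphM /= r1free r2free pfree.
  - exact: coefs_free_map.
  - rewrite (leq_trans (size_poly _ _)) // -ltnS -sp.
    by rewrite Pdiv.Ring.ltn_rmodp monic_neq0.
have r0 : r = 0.
  apply: (weierstrass_remainder_uniq lp) => //.
  exists (e - b * q2 - q1 * r2.[X] - q.[X]).
  have -> : r.[X] = r1.[X] * r2.[X] - q.[X] * p.[X].
    by rewrite -hornerM r12 hornerD hornerM addrC addKr.
  have -> : r1.[X] = b - q1 * p.[X] by rewrite -r1E subKr.
  have -> : r2.[X] = c - q2 * p.[X] by rewrite -r2E subKr.
  rewrite !mulrBl !mulrBr bcE; ring.
have r12' : r1 * r2 = q * p by rewrite r12 r0 addr0.
have [||r10|r20] := irreducible_frac_mul (@tofrac_inj S) irrp r12'.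
- by rewrite sp ltnS.
- by rewrite sp ltnS.
- by left; exists q1; rewrite -r1E r10 horner0 subr0.
- by right; exists q2; rewrite -r2E r20 horner0 subr0.
Qed.

End RegularCase.

(** * Irreducible elements and unique factorization *)

Section IrreducibleElements.
Local Open Scope mset_scope.
Local Open Scope ring_scope.

Section Transport.
Variables (D E : idomainType) (f : {rmorphism D -> E}).
Hypothesis bij_f : bijective f.

Lemma bij_unitE a : (f a \is a GRing.unit) = (a \is a GRing.unit).
Proof.
apply/idP/idP => [ufa|]; last exact: rmorph_unit.
have [g _ fK] := bij_f; apply/unitrP; exists (g (f a)^-1).
by split; apply: (bij_inj bij_f); rewrite rmorphM rmorph1 fK ?mulVr ?mulrV.
Qed.

Lemma bij_irreducible a : rirreducible a -> rirreducible (f a).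
Proof.
have [g _ fK] := bij_f; move=> [a0 aU irra]; split.
- by rewrite -(rmorph0 f) (inj_eq (bij_inj bij_f)).
- by rewrite bij_unitE.
- move=> b c; rewrite -[b]fK -[c]fK -rmorphM !bij_unitE => /(bij_inj bij_f).
  exact: irra.
Qed.

Lemma bij_rdvd a b : rdvd (f a) (f b) <-> rdvd a b.
Proof.
have [g _ fK] := bij_f; split=> [[c]|[c ->]]; last by exists (f c); rewrite rmorphM.
by rewrite -[c]fK -rmorphM => /(bij_inj bij_f) ->; exists (g c).
Qed.

Lemma bij_prime a : rprime (f a) -> rprime a.
Proof. by move=> pfa b c /bij_rdvd; rewrite rmorphM => /pfa; rewrite !bij_rdvd. Qed.

End Transport.

(** Let [x] be the least variable. While the leading monomial contains another
    variable, an automorphism lowers it; by well-foundedness this ends with a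
    power of [x]. *)
Lemma ps_irreducible_prime (K : fieldType) (I : choiceType)
  (s : powerseries K I) : rirreducible s -> rprime s.
Proof.
move=> irrs; have [s0 sU _] := irrs; have [v lv] := lead_exists s0.
have [i0 vi0] : exists i, v i <> 0%N.
  by apply: mset_neq0_ex => v0; move: sU; rewrite ps_unitE -v0 (lv.1).
have [x _ xmin] : exists2 x : I, True & forall j, True -> var_le x j.
  by apply: var_le_min; exists i0.
elim/(well_founded_ind (@mon_lt_wf I)): v s irrs lv {s0 sU i0 vi0} => v IHv s irrs lv.
have [[j jx vj]|onlyx] := pselect (exists2 j, j != x & v j != 0%N).
  have ltxj : var_lt x j by rewrite /var_lt eq_sym jx xmin.
  have [f [bij_f [m mv lm]]] := exists_lead_lowering ltxj lv vj.
  apply: (bij_prime bij_f); apply: (IHv m) => //.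
  exact: bij_irreducible.
apply: (@regular_irreducible_prime _ _ x (v x)) => //.
suff -> : msetn (v x) x = v by [].
apply/msetP => j; rewrite msetnE; case: eqVneq => [->//|jx].
by apply: contrapT => /eqP; rewrite eq_sym => vj; apply: onlyx; exists j.
Qed.

Section UniqueFactorization.
Variables (D : idomainType) (sz : D -> nat).
Hypothesis szM : forall a b, a != 0 -> b != 0 -> sz (a * b) = (sz a + sz b)%N.
Hypothesis sz_eq0 : forall a, a != 0 -> sz a = 0%N -> a \is a GRing.unit.
Hypothesis irr_prime : forall a : D, rirreducible a -> rprime a.
Implicit Types (a b c : D) (s t : seq D).

Lemma factorization_exists a : a != 0 -> a \isn't a GRing.unit ->
  exists s, rfactorization a s.
Proof.
have [n] := ubnP (sz a); elim: n a => // n IHn a an a0 aU.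
have [irra|nirra] := pselect (rirreducible a).
  by exists [:: a]; split=> [b|]; [rewrite inE => /eqP ->|rewrite big_seq1].
have [b [c [abc bU cU]]] : exists b c,
    [/\ a = b * c, b \isn't a GRing.unit & c \isn't a GRing.unit].
  apply: contrapT => nex; apply: nirra; split=> // b c abc.
  apply: contrapT => /not_orP[/negP bU /negP cU]; apply: nex.
  by exists b, c.
move: a0; rewrite abc mulf_eq0 negb_or => /andP[b0 c0].
have szpos d : d != 0 -> d \isn't a GRing.unit -> (0 < sz d)%N.
  by move=> d0; rewrite lt0n; apply: contraNneq => /sz_eq0 ->.
have szb := szpos b b0 bU; have szc := szpos c c0 cU.
have bcn : (sz b + sz c < n.+1)%N by rewrite -szM // -abc.
have [|s [irs bE]] := IHn b _ b0 bU; first by lia.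
have [|t [irt cE]] := IHn c _ c0 cU; first by lia.
exists (s ++ t); split; last by rewrite big_cat -bE -cE.
by move=> d; rewrite mem_cat => /orP[/irs|/irt].
Qed.

Lemma irreducible_dvd_prod a s u : rirreducible a -> u \is a GRing.unit ->
  rdvd a ((\prod_(b <- s) b) * u) -> exists2 b, b \in s & rdvd a b.
Proof.
move=> irra uu; elim: s => [|b s IHs].
  rewrite big_nil mul1r => -[c uE]; case: irra => _ /negP[].
  by move: uu; rewrite uE unitrM => /andP[].
rewrite big_cons -mulrA => /(irr_prime irra)[ab|/IHs[c cs ac]].
  by exists b; rewrite ?mem_head.
by exists c => //; rewrite inE cs orbT.
Qed.

(** The unit [u] absorbs the units by which matched factors differ, which makes
    the induction on [s] go through. *)
Lemma factorization_uniq s t u : u \is a GRing.unit ->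
    (forall b, b \in s -> rirreducible b) ->
    (forall b, b \in t -> rirreducible b) ->
    \prod_(b <- s) b = (\prod_(b <- t) b) * u ->
  same_factors (@rassoc D) s t.
Proof.
elim: s t u => [|a s IHs] t u uu irs irt.
  case: t irt => [_ _|b t irt]; first by exists [::].
  rewrite big_nil big_cons => tu1.
  have [_ /negP bU _] := irt b (mem_head _ _); exfalso; apply: bU.
  by apply/unitrP; exists ((\prod_(c <- t) c) * u); rewrite mulrC mulrA -tu1.
rewrite big_cons => astu; have irra := irs a (mem_head _ _).
have [b bt [c bca]] : exists2 b, b \in t & rdvd a b.
  apply: (irreducible_dvd_prod irra uu).
  by exists (\prod_(b <- s) b); rewrite -astu mulrC.
have [a0 aU _] := irra; have [_ _ /(_ _ _ bca)[uc|/(negP aU)//]] := irt b bt.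
have tt' := perm_to_rem bt.
have [||||t' rt' st'] := IHs (rem b t) (c * u).
- by rewrite unitrM uc.
- by move=> d ds; apply: irs; rewrite inE ds orbT.
- by move=> d /mem_rem /irt.
- apply: (mulfI a0); rewrite astu (perm_big _ tt') big_cons bca /=.
  by rewrite [c * a]mulrC -!mulrA; congr (a * _); rewrite mulrCA.
exists (b :: t').
  by apply: perm_trans tt' _; rewrite perm_cons.
rewrite /= st' andbT; apply/asboolP; exists c^-1; first by rewrite unitrV.
by rewrite bca [c * a]mulrC mulrK.
Qed.

Lemma ufd_of_prime : unique_factorization_domain D.
Proof.
move=> a a0 aU; split; first exact: factorization_exists.
move=> s t [irs aE] [irt aE'].
by apply: (@factorization_uniq _ _ 1); rewrite ?unitr1 // mulr1 -aE.
Qed.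

End UniqueFactorization.

End IrreducibleElements.

(** * The order of a power series *)

Section Order.
Local Open Scope mset_scope.
Local Open Scope ring_scope.
Variables (K : fieldType) (I : choiceType).
Local Notation S := (powerseries K I).
Implicit Types (m n k : {mset I}) (s t : S).

Definition has_order s d :=
  (exists2 n : {mset I}, size n = d & s n != 0) /\
  forall n : {mset I}, s n != 0 -> (d <= size n)%N.

Definition ps_order s : nat := xget 0%N [set d | has_order s d]%classic.

Definition homogeneous d s : S := fun n : {mset I} => if size n == d then s n else 0.

Lemma size_msetD m n : size (m `+` n) = (size m + size n)%N.
Proof. by rewrite (perm_size (perm_msetD m n)) size_cat. Qed.

Lemma has_order_exists s : s != 0 -> exists d, has_order s d.
Proof.
move=> /lead_exists[m [sm _]].
have ex : exists d, `[< exists2 n : {mset I}, size n = d & s n != 0 >].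
  by exists (size m); apply/asboolP; exists m.
case: (ex_minnP ex) => d /asboolP dP dmin; exists d; split=> // n sn.
by apply: dmin; apply/asboolP; exists n.
Qed.

Lemma has_order_uniq s d e : has_order s d -> has_order s e -> d = e.
Proof.
move=> [[m md sm] dmin] [[n ne sn] emin].
by apply/eqP; rewrite eqn_leq -{1}ne -{2}md dmin // emin.
Qed.

(** The component of degree [d + e] of the product is the product of the lowest
    components of the factors, which is nonzero in a domain. *)
Lemma has_orderM s t d e : has_order s d -> has_order t e ->
  has_order (s * t) (d + e).
Proof.
move=> [[m md sm] dmin] [[n ne tn] emin].
have sizeB k l : k `<=` l -> size l = (size k + size (l `\` k))%N.
  by move=> kl; rewrite -size_msetD msetBDKC.
split; last first.
  move=> k /psM_neq0[l lk /andP[sl tl]].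
  by rewrite (sizeB _ _ lk) leq_add ?dmin ?emin.
have [k kP] : exists k, (homogeneous d s * homogeneous e t) k != 0.
  have [|k [k0 _]] := @lead_exists _ _ (homogeneous d s * homogeneous e t).
    rewrite mulf_neq0 //; apply/eqP => /(congr1 (fun s : S => s _)).
      by move=> /(_ m)/eqP; rewrite /homogeneous md eqxx (negPf sm).
    by move=> /(_ n)/eqP; rewrite /homogeneous ne eqxx (negPf tn).
  by exists k.
have kde : size k = (d + e)%N.
  have [l lk /andP[]] := psM_neq0 kP; rewrite (sizeB _ _ lk) /homogeneous.
  case: (eqVneq (size l) d) => [-> _|_]; last by rewrite eqxx.
  by case: (eqVneq (size (k `\` l)) e) => [->|_] //; rewrite eqxx.
exists k => //; suff <- : (homogeneous d s * homogeneous e t) k = (s * t) k by [].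
rewrite !psME; apply: eq_fsbigr => l /set_mem lk.
have := sizeB _ _ lk; rewrite kde /homogeneous => de.
have [ld|ld|ld] := ltngtP (size (l : {mset I})) d.
- have [->|/dmin] := eqVneq (s l) 0; first by rewrite !mul0r.
  by rewrite leqNgt ld.
- have [->|/emin] := eqVneq (t (k `\` l)) 0; first by rewrite if_same !mulr0.
  by move=> ek; exfalso; lia.
- by have -> : size (k `\` (l : {mset I})) == e by apply/eqP; lia.
Qed.

Lemma ps_orderP s : s != 0 -> has_order s (ps_order s).
Proof. by move=> /has_order_exists; apply: xgetPex. Qed.

Lemma ps_orderE s d : has_order s d -> ps_order s = d.
Proof.
move=> sd; apply: has_order_uniq (sd).
by apply: (xgetPex 0%N); exists d.
Qed.

Lemma ps_orderM s t : s != 0 -> t != 0 ->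
  ps_order (s * t) = (ps_order s + ps_order t)%N.
Proof.
by move=> s0 t0; apply/ps_orderE/has_orderM; apply: ps_orderP.
Qed.

Lemma ps_order_leP s d :
  (s = 0 \/ (d <= ps_order s)%N) <-> forall n : {mset I}, (size n < d)%N -> s n = 0.
Proof.
split=> [[->//|ds] n nd|small].
  have [->//|s0] := eqVneq s 0; have [_ smin] := ps_orderP s0.
  apply: contrapT => /eqP /smin; rewrite leqNgt => /negP; apply.
  exact: leq_trans nd ds.
have [->|s0] := eqVneq s 0; [by left|right].
have [[n <- sn] _] := ps_orderP s0.
by rewrite leqNgt; apply: contraNN sn => /small ->.
Qed.

Lemma ps_order0_unit s : s != 0 -> ps_order s = 0%N -> s \is a GRing.unit.
Proof.
move=> s0 o0; have [[n + sn] _] := ps_orderP s0; rewrite o0 => /eqP.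
by rewrite size_mset_eq0 => /eqP n0; rewrite ps_unitE -n0.
Qed.

Lemma ps_orderD s t : s != 0 -> t != 0 -> s + t != 0 ->
  (minn (ps_order s) (ps_order t) <= ps_order (s + t)%R)%N.
Proof.
move=> s0 t0 st0; set d := minn _ _.
have sd : s = 0 \/ (d <= ps_order s)%N by right; apply: geq_minl.
have td : t = 0 \/ (d <= ps_order t)%N by right; apply: geq_minr.
have : s + t = 0 \/ (d <= ps_order (s + t)%R)%N.
  apply/ps_order_leP => n nd; rewrite psDE.
  by rewrite ((ps_order_leP _ _).1 sd) ?((ps_order_leP _ _).1 td) ?addr0.
by case=> // e; rewrite e eqxx in st0.
Qed.

Lemma ps_order_var i : ps_order (var K i) = 1%N.
Proof.
apply: ps_orderE; split=> [|n /var_coef ->]; last by rewrite enum_msetn.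
by exists (msetn 1 i); rewrite ?enum_msetn // /var /monomial eqxx oner_neq0.
Qed.

(** The coefficient at a monomial of degree [d] no longer changes from step
    [d.+1] on, and the limit takes this value. *)
Lemma ps_complete (u : nat -> S) :
    (forall k : nat, u k.+1 - u k = 0 \/ (k <= ps_order (u k.+1 - u k)%R)%N) ->
  exists l, forall k : nat, l - u k = 0 \/ (k <= ps_order (l - u k)%R)%N.
Proof.
move=> ucauchy; exists (fun n : {mset I} => u (size n).+1 n : K) => k.
apply/ps_order_leP => n nk; rewrite psBE.
suff -> : u k n = u (size n).+1 n by rewrite subrr.
elim: k nk => [//|k IHk]; rewrite ltnS leq_eqVlt => /predU1P[->//|nk].
rewrite -IHk //; apply/eqP; rewrite -subr_eq0 -psBE; apply/eqP.
exact: (ps_order_leP _ _).1 (ucauchy k) n nk.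
Qed.

End Order.

(** * The monoid as the monoid of monomials in its primes *)

Section MonomialEvaluation.
Local Open Scope mset_scope.
Variable M : reducedUFMonoidType.
Implicit Types (a b c d p : M) (m n k : {mset (prime_elt M)}).

Lemma mirreducible_prime p : mirreducible p -> mprime p.
Proof.
move=> irrp; split=> [|a b [c abE]]; first by case: irrp.
have [[[s fs] [t ft]] [r fr]] :=
  (mfactorization_exists a, mfactorization_exists b, mfactorization_exists c).
have fp : mfactorization p [:: p].
  by split=> [q|]; [rewrite inE => /eqP ->|rewrite big_seq1].
have := mfactorizationM fr fp; rewrite -abE => /mfactorization_perm.
move=> /(_ _ (mfactorizationM fs ft))/perm_mem/(_ p).
rewrite mem_cat mem_head orbT mem_cat => /esym/orP[ps|pt]; [left|right].
  exists (\prod_(q <- rem p s) q)%g.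
  by rewrite fs.2 (perm_big _ (perm_to_rem ps)) big_cons mulgC.
exists (\prod_(q <- rem p t) q)%g.
by rewrite ft.2 (perm_big _ (perm_to_rem pt)) big_cons mulgC.
Qed.

Lemma mprime_irreducible p : mprime p -> mirreducible p.
Proof.
move=> [np pp]; split=> // b c pE.
have p_eq e f : (p * e = p * f)%g -> e = f.
  by rewrite ![(p * _)%g]mulgC => /ufm_mulIg.
have [|[e bE]|[e cE]] := pp b c; first by exists 1%g; rewrite mul1g.
- right; exists e; apply: p_eq; rewrite mulg1.
  by rewrite [RHS]pE bE (mulgC e) -mulgA (mulgC e).
- left; exists e; apply: p_eq; rewrite mulg1.
  by rewrite [RHS]pE cE [in RHS]mulgA [RHS]mulgC.
Qed.

Definition monomial_elt n : M := (\prod_(p <- (n : seq (prime_elt M))) val p)%g.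

Lemma monomial_eltD m n : monomial_elt (m `+` n) = (monomial_elt m * monomial_elt n)%g.
Proof.
by rewrite /monomial_elt -big_cat; apply: perm_big; apply: perm_msetD.
Qed.

Lemma monomial_elt0 : monomial_elt mset0 = 1%g.
Proof. by rewrite /monomial_elt enum_mset0 big_nil. Qed.

(** In a reduced monoid with unique factorization the primes are the irreducible
    elements. *)
Lemma mfactorization_monomial n :
  mfactorization (monomial_elt n) (map val (n : seq (prime_elt M))).
Proof.
split; last by rewrite big_map.
move=> _ /mapP[p _ ->]; apply: mprime_irreducible.
by have /asboolP := valP p.
Qed.

Lemma monomial_elt_inj : injective monomial_elt.
Proof.
move=> m n mn; have := mfactorization_monomial m; rewrite mn.
move=> /mfactorization_perm/(_ (mfactorization_monomial n)) /(perm_map_inj val_inj).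
by move=> /eq_seq_msetP; rewrite !seq_mset_id.
Qed.

Lemma monomial_elt_surj a : exists n, monomial_elt n = a.
Proof.
have [s [irs ->]] := mfactorization_exists a.
elim: s irs => [|p s IHs] irs; first by exists mset0; rewrite monomial_elt0 big_nil.
have [|n nE] := IHs; first by move=> q qs; apply: irs; rewrite inE qs orbT.
have pp : `[< mprime p >].
  by apply/asboolP/mirreducible_prime/irs; rewrite mem_head.
exists (msetn 1 (Sub p pp : prime_elt M) `+` n).
by rewrite monomial_eltD nE big_cons /monomial_elt enum_msetn big_seq1 SubK.
Qed.

Lemma monomial_elt_dvd n d : mdvd d (monomial_elt n) ->
  exists2 k, k `<=` n & monomial_elt k = d.
Proof.
move=> [b nE]; have [[k kE] [l lE]] := (monomial_elt_surj d, monomial_elt_surj b).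
exists k => //; have -> : n = l `+` k.
  by apply: monomial_elt_inj; rewrite monomial_eltD lE kE.
by apply/msubsetP => i; rewrite msetE2 leq_addl.
Qed.

Lemma monomial_eltB n k : k `<=` n ->
  monomial_elt n = (monomial_elt (n `\` k) * monomial_elt k)%g.
Proof. by move=> kn; rewrite -monomial_eltD msetBDK. Qed.

End MonomialEvaluation.

(** * Dirichlet series as power series *)

Section DirichletIso.
Local Open Scope mset_scope.
Local Open Scope ring_scope.
Variables (K : fieldType) (M : reducedUFMonoidType).
Local Notation A := (dirichlet K M).
Local Notation S := (powerseries K (prime_elt M)).
Implicit Types f g : A.

(** The formal sum of [f a] times the monomial that records the prime
    factorization of [a]. *)
Definition dirichlet_series f : S := fun n => f (monomial_elt n).

Lemma dirichlet_series_zmod : zmod_morphism dirichlet_series.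
Proof. by []. Qed.

(** The divisors of the element with monomial [n] are those whose monomial
    divides [n], so the Dirichlet product is the product of power series. *)
Lemma dirichlet_series_monoid : monoid_morphism dirichlet_series.
Proof.
split=> [|f g]; apply/funext => n.
  rewrite -[LHS]/((monomial_elt n == 1%g)%:R : K) -monomial0 /monomial.
  by rewrite -(inj_eq (@monomial_elt_inj M)) monomial_elt0.
rewrite psME -[LHS]/(\sum_(d \in mdivisors (monomial_elt n))
  f d * g (mquo (monomial_elt n) d)).
rewrite (reindex_fsbig (@monomial_elt M) (submsets n)).
  apply: eq_fsbigr => k /set_mem kn.
  by rewrite /dirichlet_series (monomial_eltB kn) mquoK.
split=> [k kn|k l _ _|d /monomial_elt_dvd[k kn <-]]; last by exists k.
- by exists (monomial_elt (n `\` k)); apply: monomial_eltB.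
- exact: monomial_elt_inj.
Qed.

Lemma dirichlet_series_scalable : scalable dirichlet_series.
Proof. by []. Qed.

HB.instance Definition _ :=
  GRing.isZmodMorphism.Build A S dirichlet_series dirichlet_series_zmod.
HB.instance Definition _ :=
  GRing.isMonoidMorphism.Build A S dirichlet_series dirichlet_series_monoid.
HB.instance Definition _ :=
  GRing.isScalable.Build K A S *:%R dirichlet_series dirichlet_series_scalable.

Lemma dirichlet_series_bij : bijective dirichlet_series.
Proof.
have [mu muK] := choice (@monomial_elt_surj M).
exists (fun s : S => (fun a => s (mu a)) : A) => [f|s]; apply/funext => a.
  by rewrite /dirichlet_series muK.
by rewrite /dirichlet_series; congr s; apply: monomial_elt_inj; rewrite muK.
Qed.

End DirichletIso.

Section DirichletPullback.
Variables (K : fieldType) (M N : reducedUFMonoidType).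
Variable phi : UMagmaMorphism.type M N.
Hypothesis bij_phi : bijective phi.

Definition dirichlet_pullback (g : dirichlet K N) : dirichlet K M := g \o phi.

Lemma mdivisors_bij a : set_bij (mdivisors a) (mdivisors (phi a)) phi.
Proof.
have [psi phiK psiK] := bij_phi; split.
- by move=> d [b ->]; exists (phi b); rewrite gmulfM.
- by move=> d e _ _; apply: bij_inj.
- move=> d [b ab]; exists (psi d); last exact: psiK.
  by exists (psi b); apply: (bij_inj bij_phi); rewrite gmulfM !psiK.
Qed.

Lemma dirichlet_pullbackM : {morph dirichlet_pullback : f g / f * g}.
Proof.
move=> f g; apply/funext => a.
rewrite -[LHS]/(\sum_(d \in mdivisors (phi a)) f d * g (mquo (phi a) d)).
rewrite (reindex_fsbig _ _ _ _ (mdivisors_bij a)).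
apply: eq_fsbigr => d /set_mem [b ->].
by rewrite gmulfM !mquoK.
Qed.

Lemma dirichlet_pullback1 : dirichlet_pullback 1 = 1.
Proof.
apply/funext => a; rewrite -[LHS]/((phi a == 1%g)%:R : K).
have <- : phi 1%g = 1%g := gmulf1.
by rewrite (inj_eq (bij_inj bij_phi)).
Qed.

Lemma dirichlet_pullback_bij : bijective dirichlet_pullback.
Proof.
have [psi phiK psiK] := bij_phi.
exists (fun f : dirichlet K M => (f \o psi) : dirichlet K N) => f; apply/funext => a.
  by rewrite /dirichlet_pullback /= psiK.
by rewrite /dirichlet_pullback /= phiK.
Qed.

(** The required map is conjugate to [dirichlet_pullback], which is a ring
    isomorphism because [phi] matches the divisors of [a] with those of [phi a]. *)
Lemma powerseries_pullback :
  exists psi : {lrmorphism powerseries K (prime_elt N) ->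
                           powerseries K (prime_elt M)},
    bijective psi /\ forall g : dirichlet K N,
      psi (dirichlet_series g) = dirichlet_series (dirichlet_pullback g).
Proof.
have [inv serK invK] := @dirichlet_series_bij K N.
pose psi s := dirichlet_series (dirichlet_pullback (inv s)).
have psiE g : psi (dirichlet_series g) = dirichlet_series (dirichlet_pullback g).
  by rewrite /psi serK.
have psiB : zmod_morphism psi.
  by move=> s t; rewrite -[s]invK -[t]invK -raddfB !psiE -raddfB.
have psiM : monoid_morphism psi.
  split=> [|s t].
    by rewrite -(rmorph1 (@dirichlet_series K N)) psiE dirichlet_pullback1 rmorph1.
  rewrite -[s]invK -[t]invK -rmorphM !psiE -rmorphM.
  by rewrite -dirichlet_pullbackM.
have psiZ : scalable psi.
  by move=> c s; rewrite -[s]invK -linearZ !psiE -linearZ.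
exists (HB.pack_for {lrmorphism powerseries K (prime_elt N) ->
                                powerseries K (prime_elt M)} psi
  (GRing.isZmodMorphism.Build _ _ _ psiB) (GRing.isMonoidMorphism.Build _ _ _ psiM)
  (GRing.isScalable.Build _ _ _ _ _ psiZ)); split=> //.
have bij_inv : bijective inv by exists (@dirichlet_series K N).
have := bij_comp dirichlet_pullback_bij bij_inv.
exact: bij_comp (@dirichlet_series_bij K M).
Qed.

End DirichletPullback.

(** * The valuation and the metric of an order function *)

Section FractionValuation.
Variables (D : idomainType) (F : fieldType) (iota : {rmorphism D -> F}).
Hypothesis iota_inj : injective iota.
Hypothesis frac : forall z : F, exists a b, b != 0 /\ z = iota a / iota b.
Variable ord : D -> nat.
Hypothesis ordM : forall a b, a != 0 -> b != 0 -> ord (a * b) = (ord a + ord b)%N.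
Hypothesis ordD : forall a b, a != 0 -> b != 0 -> a + b != 0 ->
  (minn (ord a) (ord b) <= ord (a + b)%R)%N.

(** Multiplicativity of [ord] makes the difference of the orders of numerator and
    denominator independent of the fraction chosen. *)
Lemma order_valuation : exists v : F -> int, valuation v /\
  forall a, a != 0 -> v (iota a) = (ord a)%:Z.
Proof.
have iota0 a : (iota a == 0) = (a == 0).
  by rewrite -(inj_eq iota_inj) rmorph0.
have fracP : forall z, exists ab : D * D, ab.2 != 0 /\ z = iota ab.1 / iota ab.2.
  by move=> z; have [a [b ab]] := frac z; exists (a, b).
have [num numP] := choice fracP.
pose v z : int := (ord (num z).1)%:Z - (ord (num z).2)%:Z.
have vE a b : a != 0 -> b != 0 -> v (iota a / iota b) = (ord a)%:Z - (ord b)%:Z.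
  move=> a0 b0; rewrite /v; have [d0] := numP (iota a / iota b).
  move: (num _) d0 => [c d] /= d0 abcd.
  have adbc : a * d = c * b.
    apply: iota_inj; rewrite !rmorphM; apply/eqP.
    by rewrite -eqr_div ?iota0 // abcd.
  have c0 : c != 0.
    by apply: contraTneq (mulf_neq0 a0 d0) => c0; rewrite adbc c0 mul0r eqxx.
  have := ordM a0 d0; rewrite adbc ordM //; lia.
exists v; split; last first.
  have o1 : ord 1 = 0%N.
    have : ord 1 = (ord 1 + ord 1)%N by rewrite -ordM ?oner_neq0 // mulr1.
    by lia.
  move=> a a0; have := vE a 1 a0 (oner_neq0 D).
  by rewrite rmorph1 divr1 o1 subr0.
have repr z : z != 0 -> exists a b, [/\ a != 0, b != 0 & z = iota a / iota b].
  move=> z0; have [a [b [b0 zE]]] := frac z; exists a, b; split=> //.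
  by apply: contraNneq z0 => a0; rewrite zE a0 rmorph0 mul0r.
split=> y z /repr[a [b [a0 b0 ->]]] /repr[c [d [c0 d0 ->]]].
  rewrite mulf_div -!rmorphM !vE ?mulf_neq0 // !ordM //; lia.
rewrite addf_div ?iota0 // -!rmorphM -rmorphD => sum0.
have {}sum0 : a * d + c * b != 0.
  by apply: contraNneq sum0 => ->; rewrite rmorph0 mul0r.
rewrite !vE ?mulf_neq0 //.
have := ordD (mulf_neq0 a0 d0) (mulf_neq0 c0 b0) sum0; rewrite !ordM // ge_min.
rewrite geq_min.
by move: (ord (_ + _)) (ord a) (ord b) (ord c) (ord d) => o oa ob oc od; lia.
Qed.

Lemma valuation_surj (v : F -> int) : valuation v ->
    (exists2 z, z != 0 & v z = 1) ->
  discrete_valuation v.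
Proof.
move=> valv [z z0 vz]; split=> // n; have [vM _] := valv.
have v1 : v 1 = 0 by have := vM 1 1 (oner_neq0 F) (oner_neq0 F); rewrite mulr1; lia.
have vX k : v (z ^+ k) = k.
  by elim: k => // k IHk; rewrite exprS vM ?expf_neq0 // IHk vz; lia.
case: n => k; first by exists (z ^+ k); rewrite ?expf_neq0.
have zk0 : z ^+ k.+1 != 0 by rewrite expf_neq0.
exists (z ^- k.+1); first by rewrite invr_eq0.
have := vM _ _ zk0 (_ : z ^- k.+1 != 0); rewrite divff // v1 vX invr_eq0.
by move=> /(_ zk0); rewrite NegzE; lia.
Qed.

End FractionValuation.

Section OrderMetric.
Variables (D : idomainType) (v : {fraction D} -> int) (ord : D -> nat).
Hypothesis ordM : forall a b, a != 0 -> b != 0 -> ord (a * b) = (ord a + ord b)%N.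
Hypothesis ordD : forall a b, a != 0 -> b != 0 -> a + b != 0 ->
  (minn (ord a) (ord b) <= ord (a + b)%R)%N.
Hypothesis vE : forall a, a != 0 -> v (tofrac a) = (ord a)%:Z.
Implicit Types a b f g h : D.

(** The alternative [a = 0] stands for infinite order, [ord 0] being arbitrary. *)
Definition order_ge k a := a = 0 \/ (k <= ord a)%N.

Hypothesis complete_ord : forall u : nat -> D,
  (forall k, order_ge k (u k.+1 - u k)) ->
  exists l, forall k, order_ge k (l - u k).

Lemma order_opp a : ord (- a) = ord a.
Proof.
have [->|a0] := eqVneq a 0; first by rewrite oppr0.
have m0 : -1 != 0 :> D by rewrite oppr_eq0 oner_eq0.
have o1 : ord 1 = 0%N.
  have : ord 1 = (ord 1 + ord 1)%N by rewrite -ordM ?oner_neq0 // mulr1.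
  by lia.
have om1 : ord (-1) = 0%N.
  have : ord 1 = (ord (-1) + ord (-1))%N by rewrite -ordM // mulrNN mulr1.
  by rewrite o1; lia.
by rewrite -(mulN1r a) ordM // om1.
Qed.

Lemma order_geN k a : order_ge k (- a) <-> order_ge k a.
Proof.
rewrite /order_ge order_opp; split=> [[/eqP|]|[->|]]; try by right.
- by rewrite oppr_eq0 => /eqP ->; left.
- by left; rewrite oppr0.
Qed.

Lemma order_geD k a b : order_ge k a -> order_ge k b -> order_ge k (a + b).
Proof.
move=> [->|ka]; first by rewrite add0r.
move=> [->|kb]; first by rewrite addr0; right.
have [->|ab0] := eqVneq (a + b) 0; [by left|right].
have [a0|a0] := eqVneq a 0; first by rewrite a0 add0r.
have [b0|b0] := eqVneq b 0; first by rewrite b0 addr0.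
by apply: leq_trans (ordD a0 b0 ab0); rewrite leq_min ka.
Qed.

Lemma order_ge_leq k l a : (k <= l)%N -> order_ge l a -> order_ge k a.
Proof. by move=> kl [->|la]; [left|right; apply: leq_trans la]. Qed.

Variables (R : realType) (c : R).
Hypothesis c01 : 0 < c < 1.
Local Notation dist := (valuation_dist c v).

Let c_gt0 : 0 < c. Proof. by case/andP: c01. Qed.
Let c_lt1 : c < 1. Proof. by case/andP: c01. Qed.

Lemma valuation_dist_leP f g k : dist f g <= c ^+ k <-> order_ge k (f - g).
Proof.
rewrite /valuation_dist /order_ge; case: eqVneq => [->|fg].
  by rewrite subrr exprn_ge0 ?ltW //; split=> // _; left.
have fg0 : f - g != 0 by rewrite subr_eq0.
rewrite vE // -exprnP; split=> [cle|[/eqP|kle]].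
- right; rewrite leqNgt; apply: contraTN cle => lt.
  by rewrite -ltNge ltr_iXn2l.
- by rewrite (negPf fg0).
- by rewrite ler_wiXn2l // ltW.
Qed.

Lemma valuation_dist_cases f g : dist f g = 0 /\ f = g \/
  exists2 k, dist f g = c ^+ k & f <> g.
Proof.
rewrite /valuation_dist; case: eqVneq => [->|fg]; [by left|right].
by exists (ord (f - g)); [rewrite vE ?subr_eq0|apply/eqP].
Qed.

(** The triangle inequality holds in its ultrametric form. *)
Lemma valuation_metric : metric_axioms dist.
Proof.
have ge0 f g : 0 <= dist f g.
  have [[-> _]|[k -> _]] := valuation_dist_cases f g; first exact: lexx.
  by apply/exprn_ge0/ltW.
split.
- by move=> f; rewrite /valuation_dist eqxx.
- move=> f g; have [[_ ->]|[k -> _] /eqP] := valuation_dist_cases f g; first by [].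
  by rewrite expf_eq0 (gt_eqF c_gt0) andbF.
- move=> f g; rewrite /valuation_dist [g == f]eq_sym; case: eqVneq => // fg.
  have fg0 : f - g != 0 by rewrite subr_eq0.
  by rewrite -(opprB f g) !vE ?oppr_eq0 // order_opp.
- move=> g f h.
  suff [le|le] : dist f h <= dist f g \/ dist f h <= dist g h.
  + by rewrite (le_trans le) // lerDl.
  + by rewrite (le_trans le) // lerDr.
  have [[-> fg]|[k fgk _]] := valuation_dist_cases f g; first by rewrite fg; right.
  have [[-> gh]|[l ghl _]] := valuation_dist_cases g h; first by rewrite -gh; left.
  have kfg : order_ge k (f - g) by apply/valuation_dist_leP; rewrite fgk.
  have lgh : order_ge l (g - h) by apply/valuation_dist_leP; rewrite ghl.
  have fhE : f - h = (f - g) + (g - h) by rewrite addrA subrK.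
  have [kl|/ltnW lk] := leqP k l; [left; rewrite fgk|right; rewrite ghl];
    apply/valuation_dist_leP; rewrite fhE; apply: order_geD => //.
    exact: order_ge_leq lgh.
  exact: order_ge_leq kfg.
Qed.

(** Bernoulli's inequality for the powers of [c^-1]. *)
Lemma exists_expr_lt (e : R) : 0 < e -> exists k, c ^+ k < e.
Proof.
move=> e0; pose h := c^-1 - 1.
have h0 : 0 < h by rewrite subr_gt0 invf_gt1.
have bernoulli k : 1 + k%:R * h <= (1 + h) ^+ k.
  elim: k => [|k IHk]; first by rewrite mul0r addr0 expr0.
  have h1 : 0 <= 1 + h by rewrite addr_ge0 // ltW.
  rewrite exprS; apply: le_trans (ler_wpM2l h1 IHk).
  have kh : 0 <= k%:R * h ^+ 2 by rewrite mulr_ge0 // ?ler0n // exprn_ge0 // ltW.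
  by rewrite -natr1; lra.
have [k ke] : exists k : nat, (h * e)^-1 < k%:R.
  exists (Num.bound (h * e)^-1); apply: archi_boundP.
  by rewrite invr_ge0 mulr_ge0 // ltW.
exists k; rewrite -[c]invrK exprVn invf_plt ?posrE ?exprn_gt0 ?invr_gt0 //.
have -> : c^-1 = 1 + h by rewrite addrC subrK.
apply: lt_le_trans (bernoulli k).
have : e^-1 < k%:R * h.
  by move: ke; rewrite invfM ltr_pdivrMl // mulrC.
lra.
Qed.

(** Choosing for each [k] a point whose ball of radius [c ^+ k] belongs to the
    filter turns a Cauchy filter into a sequence to which [complete_ord] applies. *)
Lemma valuation_complete : complete_metric dist.
Proof.
exists valuation_metric => G PG /cauchyP cauchyG.
have ballG k : exists x : metric_space valuation_metric,
    G [set y | dist x y <= c ^+ k]%classic.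
  have [x Gx] := cauchyG (c ^+ k) (exprn_gt0 k c_gt0).
  exists x; apply: filterS Gx => y; rewrite ballEmdist /=; exact: ltW.
have [u uG] := choice ballG.
have near_u k l : (k <= l)%N -> order_ge k (u l - u k).
  move=> kl; have [y [/= uky uly]] := filter_ex (filterI (uG k) (uG l)).
  move/valuation_dist_leP: uky => uky; move/valuation_dist_leP: uly => uly.
  have -> : u l - u k = (u l - y) - (u k - y) by rewrite opprB addrA subrK.
  by apply: order_geD; [apply: order_ge_leq uly|apply/order_geN].
have [l lP] := complete_ord (fun k => near_u k k.+1 (leqnSn k)).
exists (l : metric_space valuation_metric) => A /nbhs_ballP[e /= e0 ballA].
have [k ke] := exists_expr_lt e0.
apply: filterS (uG k) => y /valuation_dist_leP uky; apply: ballA.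
rewrite ballEmdist /=; apply: le_lt_trans ke.
apply/valuation_dist_leP.
have -> : (l : D) - y = (l - u k) + (u k - y) by rewrite addrA subrK.
exact: order_geD.
Qed.

End OrderMetric.

(** * The ring of arithmetic functions *)

Section DirichletDomain.
Variables (K : fieldType) (M : reducedUFMonoidType).

Lemma dirichlet_integral : GRing.integral_domain_axiom (dirichlet K M).
Proof.
move=> f g fg0; have ser_inj := bij_inj (@dirichlet_series_bij K M).
rewrite -!(inj_eq ser_inj) rmorph0 -mulf_eq0 -rmorphM fg0.
by apply/eqP; exact: rmorph0.
Qed.

Local Notation A := (idomain_of dirichlet_integral).
Let Phi : {rmorphism A -> powerseries K (prime_elt M)} := @dirichlet_series K M.
Let bijPhi : bijective Phi := @dirichlet_series_bij K M.

Definition dirichlet_order (f : A) : nat := ps_order (Phi f).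

Let Phi_neq0 f : (Phi f != 0) = (f != 0).
Proof. by rewrite -(inj_eq (bij_inj bijPhi)) rmorph0. Qed.

Lemma dirichlet_orderM f g : f != 0 -> g != 0 ->
  dirichlet_order (f * g) = (dirichlet_order f + dirichlet_order g)%N.
Proof.
by rewrite -!Phi_neq0 /dirichlet_order => f0 g0; rewrite rmorphM ps_orderM.
Qed.

Lemma dirichlet_orderD f g : f != 0 -> g != 0 -> f + g != 0 ->
  (minn (dirichlet_order f) (dirichlet_order g) <= dirichlet_order (f + g)%R)%N.
Proof.
rewrite -!Phi_neq0 /dirichlet_order => f0 g0; rewrite rmorphD.
exact: ps_orderD.
Qed.

Lemma dirichlet_ufd : unique_factorization_domain A.
Proof.
apply: (ufd_of_prime dirichlet_orderM) => f.
  rewrite -Phi_neq0 => f0 /(ps_order0_unit f0).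
  by rewrite (bij_unitE bijPhi).
by move=> /(bij_irreducible bijPhi)/ps_irreducible_prime/(bij_prime bijPhi).
Qed.

Lemma order_ge_series k f :
  order_ge dirichlet_order k f <-> Phi f = 0 \/ (k <= ps_order (Phi f))%N.
Proof.
rewrite /order_ge; suff -> : f = 0 <-> Phi f = 0 by [].
by split=> [->|/eqP]; [rewrite rmorph0|rewrite -[_ == _]negbK Phi_neq0 negbK => /eqP].
Qed.

Lemma dirichlet_complete (u : nat -> A) :
  (forall k, order_ge dirichlet_order k (u k.+1 - u k)) ->
  exists l, forall k, order_ge dirichlet_order k (l - u k).
Proof.
move=> ucauchy; have [|s sP] := @ps_complete K _ (fun k => Phi (u k)).
  by move=> k; have := (order_ge_series _ _).1 (ucauchy k); rewrite rmorphB.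
have [inv _ invK] := bijPhi; exists (inv s) => k.
by apply/order_ge_series; rewrite rmorphB invK.
Qed.

Lemma dirichlet_order1 : (exists a : M, a <> 1%g) ->
  exists2 f : A, f != 0 & dirichlet_order f = 1%N.
Proof.
move=> [a a1]; have [n nE] := monomial_elt_surj a.
have [|i _] := @mset_neq0_ex _ n.
  by move=> n0; apply: a1; rewrite -nE n0 monomial_elt0.
have [inv _ invK] := bijPhi; exists (inv (var K i)).
  rewrite -Phi_neq0 invK; apply/eqP => /(congr1 (fun s : powerseries K _ =>
    s (msetn 1 i))) /eqP.
  by rewrite /var /monomial eqxx (negPf (oner_neq0 K)).
by rewrite /dirichlet_order invK ps_order_var.
Qed.

End DirichletDomain.

(** * The theorem *)

Theorem theorem1p1 (K : fieldType) :
  (exists Phi : forall M : reducedUFMonoidType,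
       {lrmorphism dirichlet K M -> powerseries K (prime_elt M)},
     (forall M : reducedUFMonoidType, bijective (Phi M)) /\
     (forall (M N : reducedUFMonoidType) (phi : UMagmaMorphism.type M N),
        bijective phi ->
        exists psi : {lrmorphism powerseries K (prime_elt N) ->
                                 powerseries K (prime_elt M)},
          bijective psi /\
          forall g : dirichlet K N,
            psi (Phi N g) = Phi M (g \o phi : dirichlet K M))) /\
  (forall M : reducedUFMonoidType,
     exists intA : GRing.integral_domain_axiom (dirichlet K M),
       unique_factorization_domain (idomain_of intA) /\
       exists v : {fraction idomain_of intA} -> int,
         valuation v /\
         ((exists a : M, a <> 1%g) -> discrete_valuation v) /\
         forall (R : realType) (c : R), 0 < c < 1 ->
           complete_metric (valuation_dist c v)).
Proof.
split.
  exists (fun M => @dirichlet_series K M : {lrmorphism _ -> _}); split=> [M|M N phi].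
    exact: dirichlet_series_bij.
  exact: powerseries_pullback.
move=> M; exists (@dirichlet_integral K M); split; first exact: dirichlet_ufd.
have ordM := @dirichlet_orderM K M; have ordD := @dirichlet_orderD K M.
have [v [valv vE]] := order_valuation (@tofrac_inj _) (@frac_div _) ordM ordD.
exists v; split=> //; split=> [ntM|R c c01].
  apply: valuation_surj => //.
  have [f f0 f1] := @dirichlet_order1 K M ntM.
  by exists (tofrac f); rewrite ?tofrac_eq0 // vE // f1.
exact: valuation_complete ordM ordD vE (@dirichlet_complete K M) _ _ c01.
Qed.
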